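(* Let $a<b$, $K\ge2$, $\mathcal{I}=\{1,\dots,K\}$, $\mathscr{D}\subseteq D_{cdf}([a,b])$ nonempty and convex, and $\mathsf{T}:D_{cdf}([a,b])\to\mathbb{R}$ with $|\mathsf{T}(F)-\mathsf{T}(G)|\le C\|F-G\|_\infty$ for all $F\in\mathscr{D}$, $G\in D_{cdf}([a,b])$ and some $C>0$. Suppose $\mathscr{D}$ contains $H_1,H_2$ with $J_\tau:=\tau H_1+(1-\tau)H_2\in\mathscr{D}$ for all $\tau\in[0,1]$ and $\mathsf{T}(J_{\tau_2})-\mathsf{T}(J_{\tau_1})\ge c_-(\tau_2-\tau_1)$ for all $0\le\tau_1\le\tau_2\le1$ and some $c_->0$. Let $\mathscr{M}_K\subseteq\mathscr{S}_K$ be closed with at least two elements. Then there exists a constant $c>0$, independent of $K$, $n$ and $\mathscr{M}_K$, such that for every policy $\pi$ with recommendations in $\mathscr{M}_K$ and every randomization measure $\mathbb{P}_G$, $$\sup_{F^1,\dots,F^K\in\{J_\tau:\tau\in[0,1]\}}\mathbb{E}[r_n(\pi,\mathscr{M}_K)]\ge c\,\kappa(\mathscr{M}_K)\sqrt{K/n}\quad\text{for every }n\ge K,$$ the supremum being over all potential outcome distributions with independent marginals with cdfs in $\{J_\tau:\tau\in[0,1]\}$. Furthermore, $$\kappa(\mathscr{M}_K)\ge\frac{1}{272}\max_{\delta\in\mathscr{M}_K}\|\delta\|^2\cdot\min_{j=1,\dots,K}\Big(\max_{\delta\in\mathscr{M}_K}\delta_j-\min_{\delta\in\mathscr{M}_K}\delta_j\Big)^3,$$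 and $\kappa(\mathscr{M}_K)\ge\big(\max(\min_{j=1,\dots,K}\max_{\delta\in\mathscr{M}_K}\delta_j-1/2,\,0)\big)^2$.
   Context: $D_{cdf}([a,b])$ is the set of cdfs $F$ on $\mathbb{R}$ with $F(a-)=0$, $F(b)=1$; $\|F-G\|_\infty=\sup_x|F(x)-G(x)|$; $\mathscr{S}_K=\{\delta\in[0,1]^K:\sum_i\delta_i=1\}$; $\langle\delta,\mathbf{F}\rangle=\sum_i\delta_iF^i$; $\|\cdot\|$ is the Euclidean norm. Define $$\kappa(\mathscr{M}_K)=\sup\Big\{\Big[\max_{\delta\in\mathscr{M}_K}v'\delta-\sup_{\delta\in\mathscr{T}}v'\delta\Big]\wedge\min_{i=1,\dots,K}\Big[\max_{\delta\in\mathscr{M}_K}(v'\delta+w_i\delta_i)-\sup_{\delta\in\mathscr{M}_K\setminus\mathscr{T}}(v'\delta+w_i\delta_i)\Big]\Big\},$$ the supremum over all nonempty Borel sets $\mathscr{T}\subsetneq\mathscr{M}_K$, all $v\in[-1,1]^K$ and all $w_i\in[-1,1]$, $i=1,\dots,K$. Setting: potential outcomes $Y_t=(Y_{1,t},\dots,Y_{K,t})$ i.i.d. over $t$, $Y_{i,t}$ with cdf $F^i$; randomization variables $G_t$ i.i.d. with law $\mathbb{P}_G$, independent of $(Y_t)$. A policy with recommendations in $\mathscr{M}_K$: for each $n\ge K$, measurable $\pi_{n,t}:([a,b]\times\mathbb{R})^{t-1}\times\mathbb{R}\to\mathcal{I}$ ($t\le n$) and $\pi_{n,n+1}:([a,b]\times\mathbb{R})^n\times\mathbb{R}\to\mathscr{M}_K$,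 with inputs $(Z_0,G_1)=(G_1)$, $Z_{t-1}=(Y_{\pi_{n,t-1}(Z_{t-2},G_{t-1}),t-1},G_{t-1},\dots,Y_{\pi_{n,1}(G_1),1},G_1)$. Regret: $r_n(\pi,\mathscr{M}_K)=\max_{\delta\in\mathscr{M}_K}\mathsf{T}(\langle\delta,\mathbf{F}\rangle)-\mathsf{T}(\langle\pi_{n,n+1}(Z_n,G_{n+1}),\mathbf{F}\rangle)$. *)

(* Defs.v *)
From HB Require Import structures.
From mathcomp Require Import all_boot all_order all_algebra.
From mathcomp Require Import all_classical all_reals all_analysis.
Set Implicit Arguments. Unset Strict Implicit. Unset Printing Implicit Defensive.
Import Order.TTheory GRing.Theory Num.Theory.
Import numFieldNormedType.Exports.
Local Open Scope classical_set_scope.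
Local Open Scope ring_scope.

Section defs.
Variable R : realType.

Definition is_cdf (F : R -> R) : Prop :=
  {homo F : x y / x <= y} /\
  (forall y, (F x @[x --> y^'+] --> F y)) /\
  (F x @[x --> -oo%R] --> (0:R)) /\ (F x @[x --> +oo%R] --> (1:R)).

Definition Dcdf (a b : R) : set (R -> R) :=
  [set F | is_cdf F /\ (F x @[x --> a^'-] --> (0:R)) /\ F b = 1].

Definition supdist (F G : R -> R) : R := sup (range (fun x => `|F x - G x|)).

Definition Jmix (H1 H2 : R -> R) (tau : R) : R -> R :=
  fun x => tau * H1 x + (1 - tau) * H2 x.

Definition cdf_of (mu : probability R R) : R -> R :=
  fun x => fine (mu `]-oo, x]%classic).

Definition line_laws (H1 H2 : R -> R) K : set ('I_K -> probability R R) :=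
  [set mu | forall i, exists tau, 0 <= tau <= 1 /\ cdf_of (mu i) = Jmix H1 H2 tau].

Definition mixture K (delta : 'rV[R]_K) (F : 'I_K -> R -> R) : R -> R :=
  fun x => \sum_(i < K) delta ord0 i * F i x.

Definition simplex K : set 'rV[R]_K :=
  [set d | (forall i, 0 <= d ord0 i <= 1) /\ \sum_(i < K) d ord0 i = 1].

Definition dotv K (v d : 'rV[R]_K) : R := \sum_(i < K) v ord0 i * d ord0 i.
Definition sqnorm K (d : 'rV[R]_K) : R := \sum_(i < K) d ord0 i ^+ 2.

Definition BorelRK K : set (set 'rV[R]_K) := <<s [set U | open U] >>.

(** kappa(M_K).  max over M is written as sup (attained: M is compact);
    the value  A /\ min_i B_i  is  \big[min/A]_i B_i. *)
Definition kappa K (M : set 'rV[R]_K) : R :=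
  sup [set x | exists (T : set 'rV[R]_K) (v w : 'rV[R]_K),
    [/\ T !=set0, T `<=` M, T <> M & BorelRK T] /\
    (forall i, `|v ord0 i| <= 1 /\ `|w ord0 i| <= 1) /\
        x = \big[Num.min/ (sup [set dotv v d | d in M] -
                           sup [set dotv v d | d in T])]_(i < K)
              (sup [set dotv v d + w ord0 i * d ord0 i | d in M] -
               sup [set dotv v d + w ord0 i * d ord0 i | d in M `\` T])].

Definition cylR m : set (set ('I_m -> R)) :=
  [set S | exists (i : 'I_m) (A : set R), measurable A /\ S = [set x | A (x i)]].
Definition borelRn m : set (set ('I_m -> R)) := <<s (@cylR m) >>.

(** Policies.  The history (Z_{t-1}, G_t) after t-1 periods (here written
    with t = number of past periods) is encoded as x : 'I_(2t+1) -> R with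
    x (2s) = observed outcome of period s+1, x (2s+1) = G_{s+1} (s < t),
    x (2t) = current randomisation variable G_{t+1}. *)
Local Unset Implicit Arguments.
Record policy K := Policy {
  pol_arm : nat -> forall t : nat, ('I_(t.*2.+1) -> R) -> 'I_K ;
  pol_rec : nat -> forall n : nat, ('I_(n.*2.+1) -> R) -> 'rV[R]_K }.
Arguments pol_arm {K} _ _ _ _.
Arguments pol_rec {K} _ _ _ _.
Local Set Implicit Arguments.

Definition policy_in K (M : set 'rV[R]_K) (pi : policy K) : Prop :=
  (forall n t, (K <= n)%N -> (t < n)%N -> forall k : 'I_K,
      borelRn (pol_arm pi n t @^-1` [set k])) /\
  (forall n, (K <= n)%N -> (forall x, M (pol_rec pi n n x)) /\
     forall (i : 'I_K) (A : set R), measurable A ->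
       borelRn ((fun x => pol_rec pi n n x ord0 i) @^-1` A)).

(** Data of one run with horizon n: a list s of reals, laid out period by
    period as  G_1, Y_{1,1..K}, G_2, Y_{2,1..K}, ..., G_n, Y_{n,1..K}, G_{n+1}
    (0-indexed periods below). *)
Definition gdat K (s : seq R) (t : nat) : R := nth 0 s (t * K.+1).
Definition ydat K (s : seq R) (t : nat) (i : 'I_K) : R := nth 0 s (t * K.+1 + i.+1).

(** history after t periods, as an infinite sequence (only the first 2t+1
    entries matter) *)
Fixpoint hist K (pi : policy K) (n : nat) (s : seq R) (t : nat) : nat -> R :=
  match t with
  | 0 => fun j => gdat K s 0
  | t'.+1 => fun j =>
      if (j < t'.*2)%N then hist pi n s t' j
      else if j == t'.*2 then
        ydat s t' (pol_arm pi n t' (fun i : 'I_(t'.*2.+1) => hist pi n s t' i))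
      else if j == t'.*2.+1 then gdat K s t'
      else gdat K s t
  end.

Definition recommendation K (pi : policy K) n (s : seq R) : 'rV[R]_K :=
  pol_rec pi n n (fun i : 'I_(n.*2.+1) => hist pi n s n i).

Definition regret K (T : (R -> R) -> R) (M : set 'rV[R]_K) (F : 'I_K -> R -> R)
  (pi : policy K) n (s : seq R) : R :=
  sup [set T (mixture d F) | d in M] - T (mixture (recommendation pi n s) F).

(** iterated integral against a finite list of probability measures on R:
    the integral w.r.t. their product measure (Fubini-Tonelli) *)
Fixpoint iint (mus : seq (probability R R)) (f : seq R -> \bar R) : \bar R :=
  match mus with
  | [::] => f [::]
  | mu :: mus' => (\int[mu]_x iint mus' (fun s => f (x :: s)))%E
  end.

(** laws of the data list: Y_{i,t} ~ mu i, G_t ~ PG, all independent *)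
Definition data_laws K (mu : 'I_K -> probability R R) (PG : probability R R) n
  : seq (probability R R) :=
  flatten (nseq n (PG :: [seq mu i | i <- enum 'I_K])) ++ [:: PG].

Definition exp_regret K (T : (R -> R) -> R) (M : set 'rV[R]_K)
  (mu : 'I_K -> probability R R) (PG : probability R R) (pi : policy K) n
  : \bar R :=
  iint (data_laws mu PG n) (fun s => (regret T M (fun i => cdf_of (mu i)) pi n s)%:E).

End defs.

(* Main.v *)
Require Import Defs.
From HB Require Import structures.
From mathcomp Require Import all_boot all_order all_algebra.
From mathcomp Require Import all_classical all_reals all_analysis.
From mathcomp Require Import measurable_realfun ring lra zify.
Import Order.TTheory GRing.Theory Num.Theory.
Import numFieldNormedType.Exports.
Local Open Scope classical_set_scope.
Local Open Scope ring_scope.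

(** Write [g tau := T (J_tau)].  A mixture of laws on the line is again on the
    line, so the regret is [max_d g(d.tau) - g(rec.tau)], at least
    [cminus * (d.tau - rec.tau)] for each [d] in [M].  For an admissible triple
    [(T, v, w)] of [kappa], compare the model [tau = 1/2 + eta v] with the [K]
    models in which coordinate [i] is moved by [eta w_i], where
    [eta = sqrt(K/n) / 8].  On the event [v.rec <= sup_T v] the first model
    suffers regret of order [eta], off this event the others do.  Some arm [i] is
    pulled at most [n/K] times on average, so its two models cannot be told
    apart: every observation of arm [i] is a mixture of the laws of [H1] and
    [H2], with weights whose relative entropy is of order [eta^2 = K / (64 n)].

    For the bounds on [kappa], [T] is always a half-space section
    [M /\ {v.d <= theta}].  For the first one, [v] is proportional to an almost
    maximiser [d*] of the Euclidean norm, so that [v.d] close to [v.d*] forces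
    [d] close to [d*]; for the second one, [v] is a multiple of [e_1]. *)

Set Implicit Arguments.
Unset Strict Implicit.
Unset Printing Implicit Defensive.

(** * Bounded measurable functions and their integrals under a probability measure *)

Definition bmeas {R : realType} {d : measure_display} {Z : measurableType d}
  (f : Z -> R) : Prop :=
  measurable_fun setT f /\ exists B, forall z, `|f z| <= B.

Section bounded_integrals.
Context {R : realType}.
Implicit Types (mu : probability R R) (f g : R -> R).

Lemma bmeas_integrable mu f : bmeas f -> mu.-integrable setT (EFin \o f).
Proof.
move=> [mf [B hB]]; apply: measurable_bounded_integrable => //.
  by rewrite [X in (X < _)%E](_ : _ = 1%E) ?ltry//; exact: probability_setT.
exists B; split; first exact: num_real.
by move=> M BM x _; exact: le_trans (hB x) (ltW BM).
Qed.

Lemma bmeas_cst d (Z : measurableType d) (c : R) : bmeas (fun _ : Z => c).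
Proof. by split; [exact: measurable_cst|exists `|c|]. Qed.

Lemma bmeasD d (Z : measurableType d) (f g : Z -> R) :
  bmeas f -> bmeas g -> bmeas (fun x => f x + g x).
Proof.
move=> [mf [B hB]] [mg [B' hB']]; split; first exact: measurable_funD.
by exists (B + B') => z; rewrite (le_trans (ler_normD _ _))// lerD.
Qed.

Lemma bmeasZ d (Z : measurableType d) (c : R) (f : Z -> R) :
  bmeas f -> bmeas (fun x => c * f x).
Proof.
move=> [mf [B hB]]; split; first exact: measurable_funM.
by exists (`|c| * B) => z; rewrite normrM ler_wpM2l.
Qed.

Lemma Rintegral_prob_cst mu (c : R) : \int[mu]_x c = c.
Proof.
rewrite Rintegral_cst// -[RHS](mulr1 c) -[in RHS]/(fine 1%E).
by congr (_ * fine _); exact: probability_setT.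
Qed.

Lemma Rintegral_affine mu (k1 k2 k3 : R) f g : bmeas f -> bmeas g ->
  \int[mu]_x (k1 * f x + k2 * g x + k3) =
  k1 * \int[mu]_x f x + k2 * \int[mu]_x g x + k3.
Proof.
move=> bf bg; rewrite RintegralD//; try exact/bmeas_integrable/bmeas_cst.
  rewrite RintegralD//; try exact/bmeas_integrable/bmeasZ.
  rewrite !RintegralZl//; try exact/bmeas_integrable.
  by rewrite Rintegral_prob_cst.
by apply/bmeas_integrable/bmeasD; exact: bmeasZ.
Qed.

Lemma le_Rintegral_bmeas mu f g : bmeas f -> bmeas g ->
  (forall x, f x <= g x) -> \int[mu]_x f x <= \int[mu]_x g x.
Proof.
by move=> bf bg fg; apply: le_Rintegral => //; exact: bmeas_integrable.
Qed.

Lemma normr_Rintegral_le mu f B : bmeas f -> (forall x, `|f x| <= B) ->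
  `|\int[mu]_x f x| <= B.
Proof.
move=> bf hB.
have lB x : - B <= f x <= B by rewrite -ler_norml.
rewrite ler_norml -{1}(Rintegral_prob_cst mu (- B)).
rewrite -[in X in _ && X](Rintegral_prob_cst mu B).
by apply/andP; split; apply: le_Rintegral_bmeas => //; try exact: bmeas_cst;
  move=> x; have /andP[] := lB x.
Qed.

(** Tonelli's measurability theorem concerns nonnegative integrands, so [F] is raised by its bound
    [B]; as [mu] has mass one, this raises the integral by exactly [B]. *)
Lemma bmeas_Rintegral d (Z : measurableType d) mu (F : Z -> R -> R) :
  bmeas (fun zx : Z * R => F zx.1 zx.2) ->
  bmeas (fun z => \int[mu]_x F z x).
Proof.
move=> [mF [B hB]].
have bF z : bmeas (F z).
  split; last by exists B => x; exact: (hB (z, x)).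
  exact: (measurableT_comp mF (pair1_measurable z)).
split; last first.
  by exists B => z; apply: normr_Rintegral_le => // x; exact: (hB (z, x)).
have -> : (fun z => \int[mu]_x F z x) =
          (fun z => fine (\int[mu]_x (F z x + B)%:E) - B).
  apply/funext => z.
  have -> : fine (\int[mu]_x (F z x + B)%:E) = \int[mu]_x (F z x + B) by [].
  rewrite RintegralD//; try exact/bmeas_integrable/bmeas_cst.
    by rewrite Rintegral_prob_cst addrK.
  exact: bmeas_integrable.
apply: measurable_funB; last exact: measurable_cst.
apply: measurableT_comp => //.
apply: (@measurable_fun_fubini_tonelli_F _ _ Z R R mu
  (fun zx : Z * R => (F zx.1 zx.2 + B)%:E)).
  apply/measurable_EFinP; apply: measurable_funD => //; exact: measurable_cst.
move=> x; rewrite lee_fin -lerBlDr sub0r.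
by have := hB x; rewrite ler_norml => /andP[].
Qed.

End bounded_integrals.

(** * Functions of finite lists of reals and their iterated integrals *)

Section list_measurability.
Context {R : realType}.

(** Quantifying over all [k] is harmless: beyond length [N] the default of [nth] gives the constant
    0. *)
Definition meas_coords {d : measure_display} {Z : measurableType d} (N : nat)
    (h : Z -> seq R) : Prop :=
  (forall z, size (h z) = N) /\
  forall k, measurable_fun setT (fun z => nth 0 (h z) k).

(* Bounded measurability on lists of length [N], tested against every measurable
   parametrisation so that no sigma-algebra on lists is needed. *)
Definition lmeas (N : nat) (f : seq R -> R) : Prop :=
  (forall (d : measure_display) (Z : measurableType d) (h : Z -> seq R),
     meas_coords N h -> measurable_fun setT (f \o h)) /\
  exists B, forall s, `|f s| <= B.

Lemma lmeas_bmeas N f d (Z : measurableType d) (h : Z -> seq R) :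
  lmeas N f -> meas_coords N h -> bmeas (fun z => f (h z)).
Proof.
move=> [mf [B hB]] hh; split; first exact: mf.
by exists B.
Qed.

Lemma meas_coords_cat m N d (Z : measurableType d) (h h' : Z -> seq R) :
  meas_coords m h -> meas_coords N h' ->
  meas_coords (m + N) (fun z => h z ++ h' z).
Proof.
move=> [sh mh] [sh' mh']; split; first by move=> z; rewrite size_cat sh sh'.
move=> k.
have -> : (fun z => nth 0 (h z ++ h' z) k) =
   if (k < m)%N then (fun z => nth 0 (h z) k)
   else (fun z => nth 0 (h' z) (k - m)).
  by apply/funext => z; rewrite nth_cat sh; case: ifP.
by case: ifP.
Qed.

Lemma meas_coords_cst d (Z : measurableType d) (s : seq R) :
  meas_coords (size s) (fun _ : Z => s).
Proof. by split=> // k; exact: measurable_cst. Qed.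

Lemma meas_coords1 d (Z : measurableType d) (g : Z -> R) :
  measurable_fun setT g -> meas_coords 1 (fun z => [:: g z]).
Proof. by move=> mg; split=> // -[|k] //=; rewrite nth_nil; exact: measurable_cst. Qed.

Lemma meas_coords_comp N d (Z : measurableType d) d' (Z' : measurableType d')
  (h : Z -> seq R) (g : Z' -> Z) : measurable_fun setT g ->
  meas_coords N h -> meas_coords N (fun z => h (g z)).
Proof.
by move=> mg [sh mh]; split=> // k; exact: (measurableT_comp (mh k) mg).
Qed.

Lemma lmeas_shift m N f (s0 : seq R) : size s0 = m -> lmeas (m + N) f ->
  lmeas N (fun s => f (s0 ++ s)).
Proof.
move=> sm [mf [B hB]]; split; last by exists B.
move=> d Z h hh; apply: (mf _ _ (fun z => s0 ++ h z)).
by apply: meas_coords_cat => //; rewrite -sm; exact: meas_coords_cst.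
Qed.

Lemma lmeas_cons N f (x : R) : lmeas N.+1 f -> lmeas N (fun s => f (x :: s)).
Proof. exact: (@lmeas_shift 1 N f [:: x]). Qed.

Lemma lmeas_cst N (c : R) : lmeas N (fun _ => c).
Proof. by split; [move=> *; exact: measurable_cst|exists `|c|]. Qed.

Lemma lmeasD N f g : lmeas N f -> lmeas N g -> lmeas N (fun s => f s + g s).
Proof.
move=> [mf [B hB]] [mg [B' hB']]; split.
  by move=> d Z h hh; apply: measurable_funD; [exact: mf|exact: mg].
by exists (B + B') => z; rewrite (le_trans (ler_normD _ _))// lerD.
Qed.

Lemma lmeasZ N (c : R) f : lmeas N f -> lmeas N (fun s => c * f s).
Proof.
move=> [mf [B hB]]; split.
  by move=> d Z h hh; apply: measurable_funM => //; exact: mf.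
by exists (`|c| * B) => z; rewrite normrM ler_wpM2l.
Qed.

Lemma lmeas_sum N I (r : seq I) (F : I -> seq R -> R) :
  (forall i, lmeas N (F i)) -> lmeas N (fun s => \sum_(i <- r) F i s).
Proof.
move=> hF; elim: r => [|i r ih].
  by under eq_fun do rewrite big_nil; exact: lmeas_cst.
by under eq_fun do rewrite big_cons; exact: lmeasD.
Qed.

(** Real-valued counterpart of [iint]; the two agree on [lmeas] functions by [iint_EFin], and
    linearity can then be used without infinities. *)
Fixpoint rint (mus : seq (probability R R)) (f : seq R -> R) : R :=
  match mus with
  | [::] => f [::]
  | mu :: mus' => \int[mu]_x rint mus' (fun s => f (x :: s))
  end.

(** The prefix [h z] holds the variables left free. The induction moves the variable of the first
    law into the prefix, which is then parametrised by [Z * R]; hence the quantification over all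
    [Z]. *)
Lemma bmeas_rint mus m f d (Z : measurableType d) (h : Z -> seq R) :
  lmeas (m + size mus) f -> meas_coords m h ->
  bmeas (fun z => rint mus (fun s => f (h z ++ s))).
Proof.
elim: mus m d Z h => [|mu mus ih] m d Z h mf hh.
  rewrite addn0 in mf; under eq_fun do rewrite /= cats0.
  exact: lmeas_bmeas mf hh.
rewrite /=; apply: (bmeas_Rintegral mu
  (F := fun z x => rint mus (fun s => f (h z ++ x :: s)))).
under eq_fun do under eq_fun do rewrite -cat_rcons -cats1.
apply: (ih m.+1 _ _ (fun zx : Z * R => h zx.1 ++ [:: zx.2])).
  by rewrite addSnnS.
rewrite -addn1; apply: meas_coords_cat.
  exact: (meas_coords_comp measurable_fst hh).
exact: meas_coords1.
Qed.

Lemma bmeas_rint_cons mus f : lmeas (size mus).+1 f ->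
  bmeas (fun x => rint mus (fun s => f (x :: s))).
Proof.
move=> mf.
apply: (@bmeas_rint mus 1 f _ _ (fun x : R => [:: x])) => //.
exact: meas_coords1.
Qed.

Lemma iint_EFin mus f : lmeas (size mus) f ->
  iint mus (fun s => (f s)%:E) = (rint mus f)%:E.
Proof.
elim: mus f => //= mu mus ih f mf.
have -> : (\int[mu]_x iint mus (fun s => (f (x :: s))%:E) =
          \int[mu]_x (rint mus (fun s => f (x :: s)))%:E)%E.
  by apply: eq_integral => x _; rewrite ih//; exact: lmeas_cons.
rewrite /Rintegral fineK//.
apply: integrable_fin_num => //.
exact/bmeas_integrable/bmeas_rint_cons.
Qed.

Lemma rint_affine mus (k1 k2 k3 : R) f g :
  lmeas (size mus) f -> lmeas (size mus) g ->
  rint mus (fun s => k1 * f s + k2 * g s + k3) =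
  k1 * rint mus f + k2 * rint mus g + k3.
Proof.
elim: mus f g => //= mu mus ih f g mf mg.
rewrite -Rintegral_affine; try exact: bmeas_rint_cons.
apply: eq_Rintegral => x _; rewrite ih//; exact: lmeas_cons.
Qed.

Lemma rint_cst mus (c : R) : rint mus (fun _ => c) = c.
Proof. by elim: mus => //= mu mus ->; exact: Rintegral_prob_cst. Qed.

Lemma rintD mus f g : lmeas (size mus) f -> lmeas (size mus) g ->
  rint mus (fun s => f s + g s) = rint mus f + rint mus g.
Proof.
move=> mf mg; have := rint_affine 1 1 0 mf mg.
by rewrite !mul1r addr0 => <-; congr rint; apply/funext => s; rewrite !mul1r addr0.
Qed.

Lemma rintZ mus (c : R) f : lmeas (size mus) f ->
  rint mus (fun s => c * f s) = c * rint mus f.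
Proof.
move=> mf; have := rint_affine c 0 0 mf mf.
by rewrite !mul0r !addr0 => <-; congr rint; apply/funext => s; rewrite mul0r !addr0.
Qed.

Lemma rint_sum mus I (r : seq I) (F : I -> seq R -> R) :
  (forall i, lmeas (size mus) (F i)) ->
  rint mus (fun s => \sum_(i <- r) F i s) = \sum_(i <- r) rint mus (F i).
Proof.
move=> hF; elim: r => [|i r ih].
  by under eq_fun do rewrite big_nil; rewrite rint_cst big_nil.
under eq_fun do rewrite big_cons.
by rewrite big_cons -ih rintD//; exact: lmeas_sum.
Qed.

Lemma le_rint mus f g : lmeas (size mus) f -> lmeas (size mus) g ->
  (forall s, f s <= g s) -> rint mus f <= rint mus g.
Proof.
elim: mus f g => //= mu mus ih f g mf mg fg.
apply: le_Rintegral_bmeas; try exact: bmeas_rint_cons.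
by move=> x; apply: ih => //; exact: lmeas_cons.
Qed.

End list_measurability.

(** * Existence of a law with a prescribed cdf *)

Section probability_of_cdf.
Context {R : realType} (F : R -> R) (cdfF : is_cdf F).

Let F_nd : nondecreasing F.
Proof. by case: cdfF. Qed.

Let F_rc : right_continuous F.
Proof. by case: cdfF => _ []. Qed.

#[local] HB.instance Definition _ := isCumulative.Build R _ R F F_nd F_rc.

Let F_Ny : F @ -oo --> (0:R).
Proof. by case: cdfF => _ [_ []]. Qed.

Let F_y : F @ +oo --> (1:R).
Proof. by case: cdfF => _ [_ []]. Qed.

#[local] HB.instance Definition _ := isCumulativeBounded.Build R 0 1 F F_Ny F_y.

(** The Stieltjes measure lives on the copy [measurableTypeR R] of the line; its image under the
    identity is a law on [R] itself. *)
Let idTR : measurableTypeR R -> R := idfun.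

#[local] HB.instance Definition _ :=
  @isMeasurableFun.Build _ _ _ _ idTR (@measurable_id _ _ setT).

Lemma is_cdf_probability : exists mu : probability R R, cdf_of mu = F.
Proof.
pose P : probability (measurableTypeR R) R := lebesgue_stieltjes_measure F.
exists (distribution P (idTR : {RV P >-> R}) : probability R R).
apply/funext => x; rewrite /cdf_of.
by have := @cdf_lebesgue_stieltjes_id R F x => /= ->.
Qed.

End probability_of_cdf.

(** * Mixtures of two laws *)

Section mixture_of_probabilities.
Context {R : realType} (nu1 nu2 : probability R R) (t : R) (t01 : 0 <= t <= 1).

Let t_ge0 : 0 <= t. Proof. by case/andP: t01. Qed.
Let t_le1 : 0 <= 1 - t. Proof. by rewrite subr_ge0; case/andP: t01. Qed.

Let pmix : set R -> \bar R :=
  measure_add (mscale (NngNum t_ge0) nu1) (mscale (NngNum t_le1) nu2).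

HB.instance Definition _ := Measure.on pmix.

Let pmixE A : pmix A = (t%:E * nu1 A + (1 - t)%:E * nu2 A)%E.
Proof. by rewrite /pmix measure_addE. Qed.

Let pmix_setT : pmix setT = 1%E.
Proof.
by rewrite pmixE !probability_setT !mule1 -EFinD addrC subrK.
Qed.

HB.instance Definition _ := @Measure_isProbability.Build _ _ _ pmix pmix_setT.

Lemma mixture_probability : exists P : probability R R,
  (forall x, cdf_of P x = t * cdf_of nu1 x + (1 - t) * cdf_of nu2 x) /\
  (forall f : R -> R, bmeas f ->
    \int[P]_x f x = t * \int[nu1]_x f x + (1 - t) * \int[nu2]_x f x).
Proof.
exists (pmix : probability R R); split=> [x|f bf].
  have fn (nu : probability R R) : (nu `]-oo, x]%classic \is a fin_num)%E.
    by apply: fin_num_measure; exact: measurable_itv.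
  by rewrite /cdf_of /= pmixE fineD ?fineM ?fin_numM// fn.
have [_ [B hB]] := bf.
(* Additivity of the integral in the measure is applied to a nonnegative integrand, hence the shift
   by the bound [B]. *)
have bfB : bmeas (fun x => f x + B) by apply: bmeasD => //; exact: bmeas_cst.
have shift (mu : probability R R) :
    \int[mu]_x f x = \int[mu]_x (f x + B) - B.
  rewrite RintegralD//; try exact/bmeas_integrable.
    by rewrite Rintegral_prob_cst addrK.
  exact/bmeas_integrable/bmeas_cst.
rewrite (shift pmix) (shift nu1) (shift nu2).
suff -> : \int[pmix]_x (f x + B) =
    t * \int[nu1]_x (f x + B) + (1 - t) * \int[nu2]_x (f x + B) by ring.
have fB0 x : [set: R] x -> (0 <= (f x + B)%:E)%E.
  move=> _; rewrite lee_fin -lerBlDr sub0r.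
  by have := hB x; rewrite ler_norml => /andP[].
have mfB : measurable_fun setT (fun x => (f x + B)%:E).
  by apply/measurable_EFinP; case: bfB.
rewrite /Rintegral /pmix ge0_integral_measure_add//.
rewrite !ge0_integral_mscale//= fineD ?fineM//;
  try (by rewrite fin_numM//; exact/integrable_fin_num/bmeas_integrable);
  exact/integrable_fin_num/bmeas_integrable.
Qed.

End mixture_of_probabilities.

(** * Change of measure between two models along an adaptive run *)

Section change_of_measure.
Context {R : realType}.

(** One coded list describes both models: [Some] entries are common laws, [None] entries are filled
    with [P] in one model and with [Q] in the other. *)
Definition laws (P : probability R R) (L : seq (option (probability R R))) :=
  [seq odflt P o | o <- L].

(* [None] marks the coordinates whose law differs between the two models.  At
   such a coordinate, given the earlier ones, either [f] ignores it or it costs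
   one unit of the budget [N]. *)
Fixpoint budgeted (L : seq (option (probability R R)))
    (f N : seq R -> R) : Prop :=
  match L with
  | [::] => 0 <= N [::]
  | Some _ :: L' => forall x, budgeted L' (fun s => f (x :: s)) (fun s => N (x :: s))
  | None :: L' =>
      ((forall x y s, f (x :: s) = f (y :: s)) /\
       forall x, budgeted L' (fun s => f (x :: s)) (fun s => N (x :: s))) \/
      (forall x, budgeted L' (fun s => f (x :: s)) (fun s => N (x :: s) - 1))
  end.

Context (P Q nu1 nu2 : probability R R) (t t' k : R).
Hypothesis t01 : 0 < t < 1.
Hypothesis t'01 : 0 < t' < 1.
Hypothesis mixP : forall f : R -> R, bmeas f ->
  \int[P]_x f x = t * \int[nu1]_x f x + (1 - t) * \int[nu2]_x f x.
Hypothesis mixQ : forall f : R -> R, bmeas f ->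
  \int[Q]_x f x = t' * \int[nu1]_x f x + (1 - t') * \int[nu2]_x f x.
Hypothesis k_ge : t * ln (t / t') + (1 - t) * ln ((1 - t) / (1 - t')) <= k.
Hypothesis k_ge0 : 0 <= k.

(** Since [f] takes only the values 0 and 1, [expR f = 1 + e1 * f]: the exponential moment is affine
    in [f]. *)
Let e1 : R := expR 1 - 1.

(* Donsker-Varadhan with the logarithm linearised at [c]: every term is then an
   expectation, so the bound passes through the iterated integrals without
   Jensen; the freedom in [c] absorbs the likelihood ratio of a coordinate. *)
Lemma budgeted_bound L f N (c : R) :
  lmeas (size L) f -> lmeas (size L) N ->
  (forall s, f s = 0 \/ f s = 1) -> budgeted L f N -> 0 < c ->
  rint (laws P L) f <=
  k * rint (laws P L) N + (e1 / c) * rint (laws Q L) f + (c^-1 - 1 + ln c).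
Proof.
elim: L f N c => [|o L ih] f N c mf mN f01 bud c0 /=.
  rewrite -addrA; have ->/= : e1 / c * f [::] + (c^-1 - 1 + ln c) =
      (1 + e1 * f [::]) / c - 1 + ln c by field; rewrite gt_eqF.
  have kN : 0 <= k * N [::] by rewrite mulr_ge0.
  suff h : f [::] <= (1 + e1 * f [::]) / c - 1 + ln c.
    by move: h kN; set x := (_ / c); move=> h kN; lra.
  have -> : 1 + e1 * f [::] = expR (f [::]).
    case: (f01 [::]) => ->; rewrite ?mulr0 ?addr0 ?expR0//.
    by rewrite mulr1 /e1 addrC subrK.
  (* The tangent inequality [1 + y <= expR y] at [y = f - ln c] is the linearised logarithm. *)
  have : 1 + (f [::] - ln c) <= expR (f [::] - ln c) by exact: expR_ge1Dx.
  rewrite expRB lnK//; set x := (_ / c); move=> h; lra.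
have szP : size (laws P L) = size L by rewrite size_map.
have szQ : size (laws Q L) = size L by rewrite size_map.
have bp : bmeas (fun x => rint (laws P L) (fun s => f (x :: s))).
  by apply: bmeas_rint_cons; rewrite szP.
have bq : bmeas (fun x => rint (laws Q L) (fun s => f (x :: s))).
  by apply: bmeas_rint_cons; rewrite szQ.
have bN : bmeas (fun x => rint (laws P L) (fun s => N (x :: s))).
  by apply: bmeas_rint_cons; rewrite szP.
have baff (a1 a2 a3 : R) : bmeas (fun x => a1 * rint (laws P L) (fun s => N (x :: s))
   + a2 * rint (laws Q L) (fun s => f (x :: s)) + a3).
  by apply: bmeasD; [apply: bmeasD; exact: bmeasZ|exact: bmeas_cst].
have ihx x c' : 0 < c' -> budgeted L (fun s => f (x :: s)) (fun s => N (x :: s)) ->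
    rint (laws P L) (fun s => f (x :: s)) <=
    k * rint (laws P L) (fun s => N (x :: s))
    + (e1 / c') * rint (laws Q L) (fun s => f (x :: s)) + (c'^-1 - 1 + ln c').
  by move=> c'0 budx; apply: ih => //; exact: lmeas_cons.
rewrite /= in mf mN; case: o bud => [mu|] /= bud.
  by rewrite -Rintegral_affine//; apply: le_Rintegral_bmeas => // x; exact: ihx.
case: bud => [[fx budx]|budx].
  (* An ignored coordinate makes the inner integral constant, so it may be integrated under [P]
     instead of [Q]. *)
  have qE : \int[Q]_x rint (laws Q L) (fun s => f (x :: s)) =
            \int[P]_x rint (laws Q L) (fun s => f (x :: s)).
    have -> : (fun x => rint (laws Q L) (fun s => f (x :: s))) =
             (fun=> rint (laws Q L) (fun s => f (0 :: s))).
      by apply/funext => x; congr rint; apply/funext => s; exact: fx.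
    by rewrite !Rintegral_prob_cst.
  by rewrite qE -Rintegral_affine//; apply: le_Rintegral_bmeas => // x; exact: ihx.
have [t0 t1] := andP t01; have [t'0 t'1] := andP t'01.
(* The unit of budget spent here frees a term [k], which pays for the relative entropy of one
   observation. *)
have ihx' x c' : 0 < c' ->
    rint (laws P L) (fun s => f (x :: s)) <=
    k * rint (laws P L) (fun s => N (x :: s))
    + (e1 / c') * rint (laws Q L) (fun s => f (x :: s)) + (c'^-1 - 1 + ln c' - k).
  move=> c'0; have mNx := lmeas_cons x mN.
  have := ih _ (fun s => N (x :: s) - 1) c' (lmeas_cons x mf)
    (lmeasD mNx (lmeas_cst _ _)) (fun s => f01 _) (budx x) c'0.
  rewrite rintD ?szP//; last exact: lmeas_cst.
  rewrite rint_cst; set A := rint _ _; set B := rint _ _; set C := rint _ _.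
  by rewrite mulrDr mulrN1; set D := _ * C => h; lra.
(* On each component [c] is multiplied by its likelihood ratio. Averaging with weights [t] and
   [1 - t] then turns the terms in [1 / c] into averages with weights [t'] and [1 - t'], that is
   under [Q], while the logarithms add up to [ln c] plus the relative entropy. *)
have c1 : 0 < c * (t / t') by rewrite mulr_gt0// divr_gt0.
have c2 : 0 < c * ((1 - t) / (1 - t')) by rewrite mulr_gt0// divr_gt0// subr_gt0.
have h1 := le_Rintegral_bmeas nu1 bp (baff k _ _) (fun x => ihx' x _ c1).
have h2 := le_Rintegral_bmeas nu2 bp (baff k _ _) (fun x => ihx' x _ c2).
move: h1 h2; rewrite !Rintegral_affine// (mixP bp) (mixP bN) (mixQ bq).
rewrite !lnM ?posrE ?divr_gt0 ?invr_gt0 ?subr_gt0//.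
set p1 := \int[nu1]_x _; set n1 := \int[nu1]_x _; set q1 := \int[nu1]_x _.
set p2 := \int[nu2]_x _; set n2 := \int[nu2]_x _; set q2 := \int[nu2]_x _.
move: k_ge; rewrite !lnM ?posrE ?invr_gt0 ?subr_gt0//.
set a1 := ln t; set a2 := ln t'^-1; set a3 := ln (1 - t); set a4 := ln (1 - t')^-1.
move=> hk h1 h2.
have {}h1 := ler_wpM2l (ltW t0) h1.
have t10 : 0 <= 1 - t by rewrite subr_ge0 ltW.
have {}h2 := ler_wpM2l t10 h2.
apply: le_trans (lerD h1 h2) _.
rewrite -subr_ge0.
have tn0 : t != 0 by rewrite gt_eqF.
have t1n0 : 1 - t != 0 by rewrite gt_eqF// subr_gt0.
have t'n0 : t' != 0 by rewrite gt_eqF.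
have t'1n0 : 1 - t' != 0 by rewrite gt_eqF// subr_gt0.
have cn0 : c != 0 by rewrite gt_eqF.
rewrite (_ : _ - _ = k - (t * (a1 + a2) + (1 - t) * (a3 + a4))).
  by rewrite subr_ge0.
by field; rewrite tn0 t1n0 t'n0 t'1n0 cn0.
Qed.

End change_of_measure.

(** * Measurability of histories, arms and recommendations *)

Section policy_measurability.
Context {R : realType}.

(** The sets with measurable preimage form a sigma-algebra, so checking the generating cylinders
    suffices. *)
Lemma borelRn_preimage d (Z : measurableType d) m (g : Z -> 'I_m -> R)
    (S : set ('I_m -> R)) :
  (forall i, measurable_fun setT (g ^~ i)) -> borelRn S ->
  measurable (g @^-1` S).
Proof.
move=> mg; suff : @borelRn R m `<=` [set S' | measurable (g @^-1` S')] by apply.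
apply: smallest_sub => [|_ [i [A [mA ->]]]] /=; last first.
  by rewrite -[X in measurable X]setTI; exact: mg.
split=> [|A mA|F mF] /=.
- by rewrite preimage_set0.
- by rewrite setTD preimage_setC; exact: measurableC.
- by rewrite preimage_bigcup; apply: bigcup_measurable => k _; exact: mF.
Qed.

Lemma measurable_fun_natr d (Z : measurableType d) (b : Z -> bool) :
  measurable [set z | b z] -> measurable_fun setT (fun z => (b z)%:R : R).
Proof.
move=> mb.
have -> : (fun z => (b z)%:R : R) = \1_[set z | b z].
  by apply/funext => z; rewrite indicE mem_setE.
exact: measurable_indic.
Qed.

Context {K : nat} (pi : policy R K) (M : set 'rV[R]_K) (n : nat).

Definition arm_at (s : seq R) (t : nat) : 'I_K :=
  @pol_arm R K pi n t (fun j : 'I_(t.*2.+1) => hist pi n s t j).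

Hypothesis piM : policy_in M pi.
Hypothesis Kn : (K <= n)%N.

Section coordinates.
Context (N : nat) (d : measure_display) (Z : measurableType d) (h : Z -> seq R).
Hypothesis mh : meas_coords N h.

Lemma measurable_arm_at_hist t k : (t < n)%N ->
  (forall j, measurable_fun setT (fun z => hist pi n (h z) t j)) ->
  measurable [set z | arm_at (h z) t == k].
Proof.
move=> tn mH.
rewrite (_ : [set z | _] = (fun z (j : 'I_(t.*2.+1)) => hist pi n (h z) t j)
  @^-1` (@pol_arm R K pi n t @^-1` [set k])).
  by apply: borelRn_preimage => //; exact: piM.1.
by apply/seteqP; split=> z /=; rewrite /arm_at => /eqP.
Qed.

Lemma measurable_hist t j : (t <= n)%N ->
  measurable_fun setT (fun z => hist pi n (h z) t j).
Proof.
elim: t j => [|t ih] j tn /=; first exact: mh.2.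
case: (j < t.*2)%N; first by apply: ih; exact: ltnW.
case: (j == t.*2); last by case: (j == t.*2.+1); exact: mh.2.
(* The index of the observed outcome is itself random; a sum over arms of indicator times outcome
   makes every index deterministic. *)
have -> : (fun z => ydat (h z) t (@pol_arm R K pi n t (fun j => hist pi n (h z) t j)))
   = (fun z => \sum_(k < K) (arm_at (h z) t == k)%:R * ydat (h z) t k).
  apply/funext => z; rewrite (bigD1 (arm_at (h z) t))//= eqxx mul1r.
  rewrite big1 ?addr0// => k /negbTE.
  by rewrite eq_sym => ->; rewrite mul0r.
apply: measurable_sum => k; apply: measurable_funM; last exact: mh.2.
apply: measurable_fun_natr; apply: measurable_arm_at_hist => // j'.
by apply: ih; exact: ltnW.
Qed.

Lemma measurable_arm_at t k : (t < n)%N ->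
  measurable [set z | arm_at (h z) t == k].
Proof.
by move=> tn; apply: measurable_arm_at_hist => // j; apply/measurable_hist/ltnW.
Qed.

Lemma measurable_recommendation i :
  measurable_fun setT (fun z => recommendation pi n (h z) ord0 i).
Proof.
move=> _ A mA; rewrite setTI.
rewrite (_ : _ @^-1` A = (fun z (j : 'I_(n.*2.+1)) => hist pi n (h z) n j)
  @^-1` ((fun x => @pol_rec R K pi n n x ord0 i) @^-1` A))//.
apply: borelRn_preimage; first by move=> j; exact: measurable_hist.
by have [_] := piM.2 n Kn; exact.
Qed.

Lemma measurable_dotv_recommendation (v : 'rV[R]_K) :
  measurable_fun setT (fun z => dotv v (recommendation pi n (h z))).
Proof.
apply: measurable_sum => k; apply: measurable_funM => //.
exact: measurable_recommendation.
Qed.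

End coordinates.

Lemma lmeas_arm_at N t k : (t < n)%N ->
  lmeas N (fun s => (arm_at s t == k)%:R : R).
Proof.
move=> tn; split; last by exists 1 => s; case: (_ == _); rewrite ?normr1 ?normr0.
move=> d Z h mh; apply: measurable_fun_natr; exact: measurable_arm_at mh _ _ tn.
Qed.

Lemma lmeas_halfspace N (v : 'rV[R]_K) (x : R) :
  lmeas N (fun s => (x < dotv v (recommendation pi n s))%R%:R : R).
Proof.
split; last by exists 1 => s; case: (_ < _); rewrite ?normr1 ?normr0.
move=> d Z h mh; apply: measurable_fun_natr.
have := @measurable_fun_ltr _ _ _ setT (cst x) _ (measurable_cst _)
  (measurable_dotv_recommendation mh v).
move=> /(_ measurableT [set true]); rewrite setTI; exact.
Qed.

Lemma lmeas_monotone N (v : 'rV[R]_K) (g : R -> R) :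
  {homo g : x y / x <= y} -> (exists B, forall x, `|g x| <= B) ->
  lmeas N (fun s => g (dotv v (recommendation pi n s))).
Proof.
move=> ndg [B hB]; split; last by exists B.
move=> d Z h mh.
have mg : measurable_fun setT g by apply: nondecreasing_measurable.
exact: (measurableT_comp mg (measurable_dotv_recommendation mh v)).
Qed.

End policy_measurability.

(** * Pulls of an arm as the budget of the change of measure *)

Section budget_of_an_arm.
Context {R : realType} {K : nat} (pi : policy R K) (n : nat).

(** A history reads only the randomisation variables and the outcomes of the arms actually
    pulled. *)
Lemma hist_eq (s s' : seq R) t :
  (forall t', (t' <= t)%N -> gdat K s t' = gdat K s' t') ->
  (forall t', (t' < t)%N ->
     ydat s t' (arm_at pi n s t') = ydat s' t' (arm_at pi n s t')) ->
  hist pi n s t = hist pi n s' t.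
Proof.
elim: t => [|t ih] eg ey /=; apply/funext => j; first exact: eg.
have {}ih : hist pi n s t = hist pi n s' t.
  apply: ih => t' tt; [exact/eg/leqW|exact/ey/leqW].
by rewrite -ih -!/(arm_at pi n s t) ey// !eg.
Qed.

(** The choice after [t] periods reads nothing beyond the current randomisation variable, at
    position [t * K.+1]. *)
Lemma arm_at_prefix (r s s' : seq R) t : (t * K.+1 < size r)%N ->
  arm_at pi n (r ++ s) t = arm_at pi n (r ++ s') t.
Proof.
move=> tr; rewrite /arm_at; congr pol_arm; apply/funext => j.
have e k : (k < size r)%N -> nth 0 (r ++ s) k = nth 0 (r ++ s') k.
  by move=> kr; rewrite !nth_cat kr.
congr (_ _); apply: hist_eq => t' tt; apply: e.
  exact: leq_ltn_trans (leq_mul tt (leqnn K.+1)) tr.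
have := leq_mul tt (leqnn K.+1).
have := ltn_ord (arm_at pi n (r ++ s) t'); rewrite mulSn; lia.
Qed.

(** The changed entry is the outcome of arm [i] in period [t], read only if that arm is pulled then.
    Quotient and remainder modulo [K.+1] recover the period and the arm; randomisation variables
    have remainder 0. *)
Lemma hist_unused (r s : seq R) (x y : R) t (i : 'I_K) T :
  size r = (t * K.+1 + i.+1)%N ->
  arm_at pi n r t != i ->
  hist pi n (r ++ x :: s) T = hist pi n (r ++ y :: s) T.
Proof.
move=> sr armi.
have e k : k != size r -> nth 0 (r ++ x :: s) k = nth 0 (r ++ y :: s) k.
  move=> kr; rewrite !nth_cat; case: ltnP => // rk.
  have : (0 < k - size r)%N by rewrite subn_gt0 ltn_neqAle eq_sym kr.
  by case: (k - size r)%N.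
have lk (k : 'I_K) : (k < K)%N by [].
apply: hist_eq => t' _; apply: e; rewrite sr.
  apply/eqP => /(congr1 (modn^~ K.+1)).
  by rewrite modnMl modnMDl modn_small// ltnS.
apply/eqP => h.
have ti : t' = t.
  have := congr1 (divn^~ K.+1) h.
  by rewrite /= !divnMDl// !divn_small ?addn0 ?ltnS.
have ia : (arm_at pi n (r ++ x :: s) t')%N = i :> nat.
  by move: h; rewrite ti => /eqP; rewrite eqn_add2l => /eqP [].
move: ia; rewrite ti => /val_inj.
rewrite (@arm_at_prefix r (x :: s) [::]) ?cats0; last by rewrite sr; lia.
by move=> h'; rewrite h' eqxx in armi.
Qed.

(** Starting the count at [t] gives the budget still available once the first [t] periods are
    fixed. *)
Definition arm_count (i : 'I_K) (t : nat) (s : seq R) : R :=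
  \sum_(t <= t' < n) (arm_at pi n s t' == i)%:R.

Lemma budgeted_Some (A : seq (probability R R)) L (f N : seq R -> R) :
  (forall ys, size ys = size A ->
     budgeted L (fun s => f (ys ++ s)) (fun s => N (ys ++ s))) ->
  budgeted ([seq Some a | a <- A] ++ L) f N.
Proof.
elim: A f N => [|a A ih] f N h /=; first exact: (h [::]).
move=> x; apply: ih => ys sy; have /= := h (x :: ys); apply.
by rewrite sy.
Qed.

(** One period of data for two models that differ only in the law of arm [i]. *)
Definition coded_block (mu : 'I_K -> probability R R) PG (i : 'I_K) :=
  Some PG :: [seq if j == i then None else Some (mu j) | j <- enum 'I_K].

Definition coded_laws (mu : 'I_K -> probability R R) PG (i : 'I_K) (m : nat) :=
  flatten (nseq m (coded_block mu PG i)) ++ [:: Some PG].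

Lemma laws_coded (mu mu' : 'I_K -> probability R R) PG i m :
  (forall j, j != i -> mu j = mu' j) ->
  laws (mu' i) (coded_laws mu PG i m) = data_laws mu' PG m.
Proof.
move=> e; rewrite /laws /coded_laws /data_laws map_cat map_flatten map_nseq /=.
congr (flatten (nseq _ (_ :: _)) ++ _); rewrite -map_comp; apply: eq_map => j /=.
by case: eqP => [->//|/eqP ji]; exact: e.
Qed.

(** Induction on the remaining periods, with the past data [r] fixed. The arm of a period is
    determined before the outcome of arm [i] is read: if it is [i], the count supplies the unit of
    budget, otherwise that outcome never enters a history. *)
Lemma budgeted_coded_laws (mu : 'I_K -> probability R R) PG i
    (phi : 'rV[R]_K -> R) m t (r : seq R) :
  (t + m)%N = n -> size r = (t * K.+1)%N ->
  budgeted (coded_laws mu PG i m)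
    (fun s => phi (recommendation pi n (r ++ s)))
    (fun s => arm_count i t (r ++ s)).
Proof.
elim: m t r => [|m ih] t r tmn sr.
  by move=> /= x; rewrite /arm_count big_geq// -tmn addn0.
(* The block is cut at its only open coordinate, the outcome of arm [i]. *)
have [A1 [A2 [sA1 sA2 blkE]]] : exists A1 A2 : seq (probability R R),
    [/\ size A1 = i :> nat, (size A1 + size A2).+1 = K &
    coded_block mu PG i = [seq Some a | a <- PG :: A1] ++
      None :: [seq Some a | a <- A2]].
  pose l := enum 'I_K.
  exists [seq mu j | j <- take i l], [seq mu j | j <- drop i.+1 l].
  rewrite !size_map size_takel ?size_drop ?size_enum_ord; last exact: ltnW.
  split=> //; first by have := ltn_ord i; lia.
  have lE : l = take i l ++ i :: drop i.+1 l.
    rewrite -{1}(cat_take_drop i l) (drop_nth i) ?size_enum_ord//.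
    by rewrite nth_ord_enum.
  have outside l' : i \notin l' ->
      [seq if j == i then None else Some (mu j) | j <- l'] =
      [seq Some a | a <- [seq mu j | j <- l']].
    move=> il'; rewrite -map_comp; apply/eq_in_map => j jl /=.
    by case: eqP => // ji; rewrite -ji jl in il'.
  have : uniq (take i l ++ i :: drop i.+1 l) by rewrite -lE enum_uniq.
  rewrite cat_uniq /= negb_or => /and3P[_ /andP[i1 _] /andP[i2 _]].
  by rewrite /coded_block -/l {1}lE map_cat /= eqxx !outside.
have -> : coded_laws mu PG i m.+1 = [seq Some a | a <- PG :: A1] ++
    None :: [seq Some a | a <- A2] ++ coded_laws mu PG i m.
  rewrite {1}/coded_laws -[flatten (nseq m.+1 _)]/(coded_block mu PG i ++
    flatten (nseq m (coded_block mu PG i))) {1}blkE.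
  by rewrite /coded_laws !(cat_cons, map_cons) -!catA !(cat_cons, map_cons).
apply: (@budgeted_Some (PG :: A1)) => ys sys.
pose r1 := r ++ ys.
have sr1 : size r1 = (t * K.+1 + i.+1)%N by rewrite size_cat sr sys /= sA1.
have tr1 : (t * K.+1 < size r1)%N by rewrite sr1; lia.
have armE s : arm_at pi n (r ++ ys ++ s) t = arm_at pi n r1 t.
  by rewrite catA -[in RHS](cats0 r1); exact: arm_at_prefix.
have ihx x zs : size zs = size A2 ->
   budgeted (coded_laws mu PG i m)
    (fun s => phi (recommendation pi n (r ++ ys ++ x :: zs ++ s)))
    (fun s => arm_count i t.+1 (r ++ ys ++ x :: zs ++ s)).
  move=> szs; have := ih t.+1 (r1 ++ x :: zs).
  rewrite addSnnS => /(_ tmn).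
  rewrite size_cat sr1 /= szs mulSn -addnA => /(_ ltac:(lia)).
  rewrite /r1; under eq_fun do rewrite -!catA.
  by under [in X in budgeted _ _ X]eq_fun do rewrite -!catA.
have countE s : arm_count i t (r ++ ys ++ s) =
    (arm_at pi n r1 t == i)%:R + arm_count i t.+1 (r ++ ys ++ s).
  by rewrite /arm_count big_ltn ?armE// -tmn; lia.
have [armi|armi] /= := eqVneq (arm_at pi n r1 t) i.
  right=> x; apply: budgeted_Some => zs szs.
  under [in X in budgeted _ _ X]eq_fun do
    rewrite countE armi eqxx addrC addKr.
  exact: ihx.
left; split=> [x y s|x].
  rewrite /recommendation !catA -/r1; congr (phi (pol_rec _ _ _ _ _ _)).
  by apply/funext => j; rewrite (@hist_unused r1 s x y t i n sr1).
apply: budgeted_Some => zs szs.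
under [in X in budgeted _ _ X]eq_fun do rewrite countE (negbTE armi) add0r.
exact: ihx.
Qed.

End budget_of_an_arm.

(** * Elementary inequalities for the exponential and the relative entropy *)

Section elementary_bounds.
Context {R : realType}.

Lemma expR1_le4 : expR 1 <= 4 :> R.
Proof.
have h : expR (2^-1) <= 2 :> R.
  have := @expR_ge1Dx R (- 2^-1).
  rewrite expRN -[(expR _)^-1]div1r ler_pdivlMr ?expR_gt0//.
  lra.
have -> : 1 = 2^-1 + 2^-1 :> R by lra.
rewrite expRD; have := expR_gt0 (2^-1 : R); nra.
Qed.

Lemma ln_le_sub1 (x : R) : 0 < x -> ln x <= x - 1.
Proof.
move=> x0; have := @le_ln1Dx R (x - 1).
by rewrite [1 + _]addrC subrK; apply; lra.
Qed.

(** Relative entropy is at most the chi-square divergence, by [ln x <= x - 1]. *)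
Lemma binary_kl_le (t t' : R) : 0 < t < 1 -> 0 < t' < 1 ->
  t * ln (t / t') + (1 - t) * ln ((1 - t) / (1 - t')) <=
  (t - t') ^+ 2 / (t' * (1 - t')).
Proof.
move=> /andP[t0 t1] /andP[t'0 t'1].
have h1 : ln (t / t') <= t / t' - 1 by apply: ln_le_sub1; rewrite divr_gt0.
have h2 : ln ((1 - t) / (1 - t')) <= (1 - t) / (1 - t') - 1.
  by apply: ln_le_sub1; rewrite divr_gt0// subr_gt0.
have -> : (t - t') ^+ 2 / (t' * (1 - t')) =
    t * (t / t' - 1) + (1 - t) * ((1 - t) / (1 - t') - 1).
  by field; rewrite !gt_eqF// subr_gt0.
by rewrite lerD// ler_wpM2l// ?ltW// subr_gt0.
Qed.

End elementary_bounds.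

(** * Linear forms on the simplex *)

Section simplex_facts.
Context {R : realType} {K : nat}.
Implicit Types (v d : 'rV[R]_K).

Lemma dotv_simplex_bounds v d (lo hi : R) : simplex d ->
  (forall i, lo <= v ord0 i <= hi) -> lo <= dotv v d <= hi.
Proof.
move=> [d01 d1] hv; rewrite -[in X in X && _](mulr1 lo).
rewrite -[in X in _ && X](mulr1 hi) -d1 !mulr_sumr.
by apply/andP; split; apply: ler_sum => i _; rewrite ler_wpM2r//;
  have /andP[] := d01 i; have /andP[] := hv i.
Qed.

Lemma dotv_shift v d (a e : R) : simplex d ->
  dotv (\row_i (a + e * v ord0 i)) d = a + e * dotv v d.
Proof.
move=> [_ d1]; rewrite /dotv -[in RHS](mulr1 a) -d1 !mulr_sumr -big_split/=.
by apply: eq_bigr => i _; rewrite !mxE mulrDl mulrA.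
Qed.

Lemma dotv_perturb v d (e : R) (i : 'I_K) :
  dotv (\row_j (v ord0 j + if j == i then e else 0)) d = dotv v d + e * d ord0 i.
Proof.
rewrite /dotv [in RHS](bigD1 i)//= [in LHS](bigD1 i)//= !mxE eqxx mulrDl.
rewrite addrAC; congr (_ + _ + _); apply: eq_bigr => j /negbTE ji.
by rewrite !mxE ji addr0.
Qed.

End simplex_facts.

(** * Regret when all arms have laws on the line *)

Section regret_on_the_line.
Context {R : realType} (T : (R -> R) -> R) (H1 H2 : R -> R) (cm : R).
Hypothesis cm0 : 0 < cm.
Hypothesis T_mono : forall t1 t2, 0 <= t1 -> t1 <= t2 -> t2 <= 1 ->
  T (Jmix H1 H2 t2) - T (Jmix H1 H2 t1) >= cm * (t2 - t1).

(** [T_mono] speaks of parameters in [0, 1] only; clamping makes [g] monotone and bounded on all of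
    [R], as [lmeas_monotone] asks. *)
Let g (x : R) : R := T (Jmix H1 H2 (Num.max 0 (Num.min 1 x))).

Let clamp01 (x : R) : 0 <= Num.max 0 (Num.min 1 x) <= 1.
Proof. by rewrite /Num.max /Num.min; case: (ltP 1 x) => h1; case: ltP => h2; lra. Qed.

Let clampK (x : R) : 0 <= x <= 1 -> Num.max 0 (Num.min 1 x) = x.
Proof.
by move=> /andP[x0 x1]; rewrite (min_idPr x1) (max_idPr x0).
Qed.

Let g_nd : {homo g : x y / x <= y}.
Proof.
move=> x y xy; rewrite -subr_ge0.
have xy' : Num.max 0 (Num.min 1 x) <= Num.max 0 (Num.min 1 y) :> R.
  by rewrite ge_max !le_max lexx /= [X in _ || X]le_min !ge_min lexx xy !orbT.
have /andP[x0 x1] := clamp01 x; have /andP[y0 y1] := clamp01 y.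
apply: le_trans (T_mono x0 xy' y1).
by apply: mulr_ge0; [exact: ltW|rewrite subr_ge0].
Qed.

Let g_bounds x : g 0 <= g x <= g 1.
Proof.
have e0 : Num.max 0 (Num.min 1 0) = 0 :> R by apply: clampK; lra.
have e1 : Num.max 0 (Num.min 1 1) = 1 :> R by apply: clampK; lra.
have /andP[x0 x1] := clamp01 x.
have ex : g x = g (Num.max 0 (Num.min 1 x)) by rewrite /g (clampK (clamp01 x)).
by rewrite ex; apply/andP; split; apply: g_nd.
Qed.

Context (K : nat) (M : set 'rV[R]_K) (pi : policy R K) (n : nat).
Hypothesis MS : M `<=` @simplex R K.
Hypothesis piM : policy_in M pi.
Hypothesis Kn : (K <= n)%N.
Context (mu : 'I_K -> probability R R) (tau : 'rV[R]_K).
Hypothesis tau01 : forall i, 0 <= tau ord0 i <= 1.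
Hypothesis cdf_mu : forall i, cdf_of (mu i) = Jmix H1 H2 (tau ord0 i).

Let F := fun i => cdf_of (mu i).

Lemma T_mixture d : simplex d -> T (mixture d F) = g (dotv tau d).
Proof.
move=> Sd; rewrite /g clampK; last exact: dotv_simplex_bounds Sd tau01.
congr T; apply/funext => x; rewrite /mixture /F.
under eq_bigr do rewrite cdf_mu /Jmix.
case: Sd => _ d1; rewrite /Jmix -[X in _ = _ + (X - _) * _]d1 /dotv -sumrB !mulr_suml.
rewrite -big_split/=; apply: eq_bigr => i _; ring.
Qed.

Lemma recommendation_in s : M (recommendation pi n s).
Proof. by have [+ _] := piM.2 n Kn; apply. Qed.

Let supM := sup [set T (mixture d F) | d in M].

Let has_ub : has_ubound [set T (mixture d F) | d in M].
Proof.
exists (g 1) => _ [d Md <-]; rewrite T_mixture; last exact: MS.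
by have /andP[] := g_bounds (dotv tau d).
Qed.

Lemma regretE s :
  regret T M F pi n s = supM - g (dotv tau (recommendation pi n s)).
Proof. by rewrite /regret T_mixture//; exact/MS/recommendation_in. Qed.

Lemma regret_ge0 s : 0 <= regret T M F pi n s.
Proof.
rewrite /regret subr_ge0; apply: (ub_le_sup has_ub).
by exists (recommendation pi n s) => //; exact: recommendation_in.
Qed.

Lemma regret_ge s d : M d ->
  cm * (dotv tau d - dotv tau (recommendation pi n s)) <= regret T M F pi n s.
Proof.
(* If the recommendation has the larger parameter, the left side is nonpositive and nonnegativity of
   the regret suffices. *)
move=> Md; have [le|gt] := leP (dotv tau (recommendation pi n s)) (dotv tau d);
  last first.
  apply: le_trans (regret_ge0 s).
  by rewrite mulr_ge0_le0 ?(ltW cm0)// subr_le0 ltW.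
have rb := dotv_simplex_bounds (MS (recommendation_in s)) tau01.
have db := dotv_simplex_bounds (MS Md) tau01.
rewrite regretE.
have h : T (mixture d F) <= supM by apply: (ub_le_sup has_ub); exists d.
apply: le_trans (lerB h (lexx _)).
rewrite T_mixture; last exact: MS.
rewrite /g !clampK//; apply: T_mono => //; first by case/andP: rb.
by case/andP: db.
Qed.

Lemma lmeas_regret N : lmeas N (regret T M F pi n).
Proof.
rewrite (_ : regret _ _ _ _ _ = fun s =>
  supM + (-1) * g (dotv tau (recommendation pi n s))); last first.
  by apply/funext => s; rewrite regretE mulN1r.
apply: lmeasD; first exact: lmeas_cst.
apply: lmeasZ; apply: (lmeas_monotone piM Kn) => //.
exists (`|g 0| + `|g 1|) => x; have /andP[h0 h1] := g_bounds x.
have := ler_norm (g 1); have := ler_norm (- g 0); rewrite normrN => h2 h3.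
have := normr_ge0 (g 0); have := normr_ge0 (g 1) => h4 h5.
by rewrite ler_norml; apply/andP; split; lra.
Qed.

Lemma exp_regretE PG :
  exp_regret T M mu PG pi n = (rint (data_laws mu PG n) (regret T M F pi n))%:E.
Proof. by rewrite /exp_regret iint_EFin//; exact: lmeas_regret. Qed.

End regret_on_the_line.

(** * The regret lower bound for one admissible triple *)

Section lower_bound.
Context {R : realType} (T : (R -> R) -> R) (H1 H2 : R -> R) (cm : R).
Hypothesis cm0 : 0 < cm.
Hypothesis T_mono : forall t1 t2, 0 <= t1 -> t1 <= t2 -> t2 <= 1 ->
  T (Jmix H1 H2 t2) - T (Jmix H1 H2 t1) >= cm * (t2 - t1).
Hypothesis cdfH1 : is_cdf H1.
Hypothesis cdfH2 : is_cdf H2.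

(** One pair [nu1], [nu2] serves all parameters, so any two models mix the same components, as
    [budgeted_bound] requires. *)
Lemma line_probabilities : exists (nu1 nu2 : probability R R)
  (P : R -> probability R R), forall t, 0 <= t <= 1 ->
    cdf_of (P t) = Jmix H1 H2 t /\
    forall f : R -> R, bmeas f ->
      \int[P t]_x f x = t * \int[nu1]_x f x + (1 - t) * \int[nu2]_x f x.
Proof.
have [nu1 c1] := is_cdf_probability cdfH1.
have [nu2 c2] := is_cdf_probability cdfH2.
exists nu1, nu2.
suff /choice [P hP] : forall t : R, exists P : probability R R, 0 <= t <= 1 ->
    cdf_of P = Jmix H1 H2 t /\
    forall f : R -> R, bmeas f ->
      \int[P]_x f x = t * \int[nu1]_x f x + (1 - t) * \int[nu2]_x f x.
  by exists P.
move=> t; have [t01|t01] := boolP (0 <= t <= 1); last by exists nu1.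
have [P [hc hi]] := mixture_probability nu1 nu2 t01; exists P => _; split=> //.
by apply/funext => x; rewrite hc c1 c2.
Qed.

Context (K : nat) (M : set 'rV[R]_K) (pi : policy R K) (n : nat)
  (PG : probability R R).
Hypothesis K2 : (2 <= K)%N.
Hypothesis MS : M `<=` @simplex R K.
Hypothesis piM : policy_in M pi.
Hypothesis Kn : (K <= n)%N.

Let supR := ereal_sup [set exp_regret T M mu PG pi n | mu in @line_laws R H1 H2 K].

Let K0 : 0 < K%:R :> R. Proof. by rewrite ltr0n; lia. Qed.
Let n0 : 0 < n%:R :> R. Proof. by rewrite ltr0n; lia. Qed.

Let eta : R := Num.sqrt (K%:R / n%:R) / 8.

Let eta_sqr : eta ^+ 2 = K%:R / n%:R / 64.
Proof.
rewrite /eta expr_div_n sqr_sqrtr; last by rewrite divr_ge0 ?ltW.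
by congr (_ / _); rewrite -natrX.
Qed.

Let eta_bounds : 0 < eta <= 8^-1.
Proof.
rewrite /eta divr_gt0 ?sqrtr_gt0 ?divr_gt0//= ler_pdivrMr// mulVf//.
rewrite -[leRHS]sqrtr1; apply: ler_wsqrtr.
by rewrite ler_pdivrMr// mul1r ler_nat.
Qed.

Lemma lmeas_arm_count N i : lmeas N (arm_count pi n i 0).
Proof.
rewrite /arm_count; under eq_fun do rewrite big_mkord.
by apply: lmeas_sum => t; exact: (lmeas_arm_at piM Kn).
Qed.

(** Each period pulls exactly one arm, so the expected counts sum to [n] and cannot all exceed
    [n / K]. *)
Lemma exists_rare_arm (mu : 'I_K -> probability R R) :
  exists i, rint (data_laws mu PG n) (arm_count pi n i 0) <= n%:R / K%:R.
Proof.
apply: contrapT => hno.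
have gt i : n%:R / K%:R < rint (data_laws mu PG n) (arm_count pi n i 0).
  by rewrite ltNge; apply/negP => h; apply: hno; exists i.
have hasK : has xpredT (index_enum 'I_K).
  have i0 : 'I_K by exists 0%N; lia.
  by apply/hasP; exists i0 => //; rewrite mem_index_enum.
have := ltr_sum hasK (fun i _ => gt i).
rewrite -rint_sum; last by move=> i; exact: lmeas_arm_count.
rewrite (_ : (fun s => \sum_(i <- _) _) = fun=> n%:R).
  rewrite rint_cst sumr_const card_ord -[X in X < _]mulr_natr divfK ?ltxx//.
  by rewrite gt_eqF.
apply/funext => s; rewrite /arm_count exchange_big/=.
rewrite (eq_bigr (fun=> 1)); last first.
  move=> t _; rewrite (bigD1 (arm_at pi n s t))//= eqxx big1 ?addr0// => i.
  by rewrite eq_sym => /negbTE ->.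
by rewrite sumr_const_nat subn0.
Qed.

Lemma regret_lower_bound (Tm : set 'rV[R]_K) (v w : 'rV[R]_K) (x : R) :
  Tm !=set0 -> Tm `<=` M -> Tm <> M ->
  (forall i, `|v ord0 i| <= 1 /\ `|w ord0 i| <= 1) ->
  x <= sup [set dotv v d | d in M] - sup [set dotv v d | d in Tm] ->
  (forall i, x <= sup [set dotv v d + w ord0 i * d ord0 i | d in M] -
     sup [set dotv v d + w ord0 i * d ord0 i | d in M `\` Tm]) ->
  ((cm / 64 * x * Num.sqrt (K%:R / n%:R))%:E <= supR)%E.
Proof.
move=> [d0 Td0] TM TnM vw xA xB.
have [nu1 [nu2 [P hP]]] := line_probabilities.
have M0 : M !=set0 by exists d0; exact: TM.
have /andP[e0 e8] := eta_bounds.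
have v1 i : -1 <= v ord0 i <= 1 by rewrite -ler_norml; case: (vw i).
have w1 i : -1 <= w ord0 i <= 1 by rewrite -ler_norml; case: (vw i).
pose tau0 : 'rV[R]_K := \row_j (2^-1 + eta * v ord0 j).
pose taui i : 'rV[R]_K := \row_j (tau0 ord0 j + if j == i then eta * w ord0 i else 0).
have tau0b i : 3 / 8 <= tau0 ord0 i <= 5 / 8.
  rewrite mxE; have /andP[a1 a2] := v1 i.
  by apply/andP; split; nra.
have tauib i j : 4^-1 <= taui i ord0 j <= 3 / 4.
  rewrite mxE; have /andP[b1 b2] := tau0b j; have /andP[a1 a2] := w1 i.
  by case: ifP => _; apply/andP; split; nra.
have tau001 i : 0 <= tau0 ord0 i <= 1 by have := tau0b i; lra.
have taui01 i j : 0 <= taui i ord0 j <= 1 by have := tauib i j; lra.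
pose mu0 j := P (tau0 ord0 j).
pose mui i j := P (taui i ord0 j).
have cdf0 j : cdf_of (mu0 j) = Jmix H1 H2 (tau0 ord0 j).
  by case: (hP _ (tau001 j)).
have cdfi i j : cdf_of (mui i j) = Jmix H1 H2 (taui i ord0 j).
  by case: (hP _ (taui01 i j)).
have line0 : line_laws H1 H2 mu0 by move=> j; exists (tau0 ord0 j).
have linei i : line_laws H1 H2 (mui i) by move=> j; exists (taui i ord0 j).
pose r0 := regret T M (fun j => cdf_of (mu0 j)) pi n.
pose ri i := regret T M (fun j => cdf_of (mui i j)) pi n.
have sup0 : ((rint (data_laws mu0 PG n) r0)%:E <= supR)%E.
  apply: ereal_sup_ubound; exists mu0 => //.
  exact: (exp_regretE cm0 T_mono MS piM Kn tau001 cdf0).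
have supi i : ((rint (data_laws (mui i) PG n) (ri i))%:E <= supR)%E.
  apply: ereal_sup_ubound; exists (mui i) => //.
  exact: (exp_regretE cm0 T_mono MS piM Kn (taui01 i) (cdfi i)).
have mr0 N : lmeas N r0 := lmeas_regret cm0 T_mono MS piM Kn tau001 cdf0 N.
have mri i N : lmeas N (ri i) :=
  lmeas_regret cm0 T_mono MS piM Kn (taui01 i) (cdfi i) N.
have r0_ge0 s : 0 <= r0 s := regret_ge0 cm0 T_mono MS piM Kn tau001 cdf0 s.
have ri_ge0 i s : 0 <= ri i s :=
  regret_ge0 cm0 T_mono MS piM Kn (taui01 i) (cdfi i) s.
have -> : cm / 64 * x * Num.sqrt (K%:R / n%:R) = cm * eta * x / 8.
  by rewrite /eta; field.
have ce0 : 0 < cm * eta by rewrite mulr_gt0.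
have [x0|x0] := leP x 0.
  apply: le_trans sup0; rewrite lee_fin.
  apply: (@le_trans _ _ 0).
    by move: ce0; set z := cm * eta => ce0; nra.
  rewrite -[leLHS](rint_cst (data_laws mu0 PG n)).
  by apply: le_rint => //; exact: lmeas_cst.
set A0 := sup [set dotv v d | d in M] in xA.
pose theta := sup [set dotv v d | d in Tm].
(* Where [f] is 1 the recommendation lies outside [Tm]; where it is 0 its [v]-value is at most
   [theta], so the first gap applies. *)
pose f s : R := (theta < dotv v (recommendation pi n s))%R%:R.
have mf N : lmeas N f := lmeas_halfspace piM Kn N v theta.
have f01 s : f s = 0 \/ f s = 1 by rewrite /f; case: (_ < _)%R; [right|left].
have y0 : 0 < cm * eta * x by exact: mulr_gt0.
have recM s : M (recommendation pi n s) := recommendation_in piM Kn s.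
have hr0 s : cm * eta * x * (1 - f s) <= r0 s.
  rewrite /f; case: ltP => h; first by rewrite subrr mulr0.
  rewrite subr0 mulr1.
  have hd d : M d -> dotv v d <= r0 s / (cm * eta) + dotv v (recommendation pi n s).
    move=> Md; rewrite -lerBlDr ler_pdivlMr//.
    have := regret_ge cm0 T_mono MS piM Kn tau001 cdf0 s Md.
    rewrite !dotv_shift; try exact: MS.
    by rewrite -/r0 -/(r0 s); set z := r0 s; nra.
  have : A0 <= r0 s / (cm * eta) + dotv v (recommendation pi n s).
    apply: ge_sup; first by case: M0 => d Md; exists (dotv v d); exists d.
    by move=> _ [d Md <-]; exact: hd.
  move=> hA; have {}hA : x <= r0 s / (cm * eta) by move: h xA; rewrite -/theta; lra.
  by move: hA; rewrite ler_pdivlMr// mulrC.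
have hri i s : cm * eta * x * f s <= ri i s.
  rewrite /f; case: ltP => h; last by rewrite mulr0.
  rewrite mulr1.
  set rec := recommendation pi n s.
  have dE d : M d -> dotv (taui i) d = 2^-1 + eta * (dotv v d + w ord0 i * d ord0 i).
    move=> Md; rewrite dotv_perturb dotv_shift; last exact: MS.
    by ring.
  have hd d : M d -> dotv v d + w ord0 i * d ord0 i <=
      ri i s / (cm * eta) + (dotv v rec + w ord0 i * rec ord0 i).
    move=> Md; rewrite -lerBlDr ler_pdivlMr//.
    have := regret_ge cm0 T_mono MS piM Kn (taui01 i) (cdfi i) s Md.
    rewrite !dE//.
    rewrite -/ri -/(ri i s) -/rec; set z := ri i s.
    set a := dotv v d + _; set b := dotv v rec + _; nra.
  have : sup [set dotv v d + w ord0 i * d ord0 i | d in M] <=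
      ri i s / (cm * eta) + (dotv v rec + w ord0 i * rec ord0 i).
    apply: ge_sup.
      by case: M0 => d Md; exists (dotv v d + w ord0 i * d ord0 i); exists d.
    by move=> _ [d Md <-]; exact: hd.
  have dbound d : M d -> dotv v d + w ord0 i * d ord0 i <= 2.
    move=> Md; have /andP[_ h1] := dotv_simplex_bounds (MS Md) v1.
    have [/(_ i) /andP[d1 d2] _] := MS Md; have /andP[a1 a2] := w1 i; nra.
  have : dotv v rec + w ord0 i * rec ord0 i <=
      sup [set dotv v d + w ord0 i * d ord0 i | d in M `\` Tm].
    apply: ub_le_sup; first by exists 2 => _ [d [Md _] <-]; exact: dbound.
    exists rec => //; split; first exact: recM.
    move=> Trec; move: h; rewrite ltNge => /negP; apply.
    apply: ub_le_sup; last by exists rec.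
    exists 1 => _ [d /TM Md <-].
    by have /andP[] := dotv_simplex_bounds (MS Md) v1.
  move=> hB hA; have {}hA : x <= ri i s / (cm * eta) by have := xB i; lra.
  by move: hA; rewrite ler_pdivlMr// mulrC.
have [i mi] := exists_rare_arm mu0.
pose L := coded_laws mu0 PG i n.
have L0 : laws (mu0 i) L = data_laws mu0 PG n by exact: laws_coded.
have Li : laws (mui i i) L = data_laws (mui i) PG n.
  apply: laws_coded => j ji; rewrite /mui /mu0 /taui !mxE (negbTE ji) addr0 //.
have t01 : 0 < tau0 ord0 i < 1 by have := tau0b i; lra.
have t'01 : 0 < taui i ord0 i < 1 by have := tauib i i; lra.
(* The parameter of arm [i] moves by at most [eta], and [t' * (1 - t') >= 3 / 16] for [t'] in
   [1/4, 3/4]. *)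
pose k : R := 16 / 3 * eta ^+ 2.
have k0 : 0 <= k by rewrite mulr_ge0// sqr_ge0.
have kge : tau0 ord0 i * ln (tau0 ord0 i / taui i ord0 i) +
   (1 - tau0 ord0 i) * ln ((1 - tau0 ord0 i) / (1 - taui i ord0 i)) <= k.
  apply: le_trans (binary_kl_le t01 t'01) _.
  have /andP[b1 b2] := tauib i i; have /andP[a1 a2] := w1 i.
  have -> : tau0 ord0 i - taui i ord0 i = - (eta * w ord0 i).
    by rewrite [taui _ _ _]mxE eqxx opprD addNKr.
  rewrite sqrrN exprMn ler_pdivrMr; last by apply: mulr_gt0; lra.
  have w2 : w ord0 i ^+ 2 <= 1 by nra.
  have q : 3 / 16 <= taui i ord0 i * (1 - taui i ord0 i) by nra.
  have e2 : 0 <= eta ^+ 2 by exact: sqr_ge0.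
  rewrite /k; set z := taui i ord0 i * _ in q *; nra.
have mN : lmeas (size L) (arm_count pi n i 0) := lmeas_arm_count _ i.
have bud : budgeted L f (arm_count pi n i 0).
  exact: (@budgeted_coded_laws R K pi n mu0 PG i
    (fun d => (theta < dotv v d)%R%:R) n 0 [::]).
(* With [c = 1] the additive term vanishes, leaving [p <= k * m + (expR 1 - 1) * q]. *)
have := budgeted_bound t01 t'01 (hP _ (tau001 i)).2 (hP _ (taui01 i i)).2 kge k0
  (mf _) mN f01 bud ltr01.
rewrite -/(mu0 i) -/(mui i i) L0 Li invr1 subrr ln1 addr0 mulr1 addr0.
set p := rint (data_laws mu0 PG n) f; set q := rint (data_laws (mui i) PG n) f.
move: mi; set m := rint _ (arm_count _ _ _ _) => mi hp.
have km : k * m <= 12^-1.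
  have -> : 12^-1 = k * (n%:R / K%:R) :> R.
    by rewrite /k eta_sqr; field; rewrite !gt_eqF.
  by rewrite ler_wpM2l.
have q0 : 0 <= q.
  rewrite -[leLHS](rint_cst (data_laws (mui i) PG n)); apply: le_rint => //.
  exact: lmeas_cst.
have eq3 : (expR 1 - 1) * q <= 3 * q.
  by rewrite ler_wpM2r//; have := @expR1_le4 R; lra.
have E0 : cm * eta * x * (1 - p) <= rint (data_laws mu0 PG n) r0.
  have -> : cm * eta * x * (1 - p) =
      rint (data_laws mu0 PG n) (fun s => cm * eta * x * (1 + (-1) * f s)).
    rewrite rintZ ?rintD ?rintZ ?rint_cst ?mulN1r//; try exact: lmeas_cst.
      exact: lmeasZ.
    by apply: lmeasD; [exact: lmeas_cst|exact: lmeasZ].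
  apply: le_rint => //.
    by apply: lmeasZ; apply: lmeasD; [exact: lmeas_cst|exact: lmeasZ].
  by move=> s; rewrite mulN1r.
have Ei : cm * eta * x * q <= rint (data_laws (mui i) PG n) (ri i).
  by rewrite -rintZ//; apply: le_rint => //; exact: lmeasZ.
(* If [q >= 1/8], the model with arm [i] moved has the regret; otherwise [p <= 1/12 + 3/8], so
   [1 - p > 1/8] and the base model has it. *)
have [q8|q8] := leP (8^-1) q.
  apply: le_trans (supi i); rewrite lee_fin; apply: le_trans Ei.
  by rewrite ler_pM2l.
apply: le_trans sup0; rewrite lee_fin; apply: le_trans E0.
rewrite ler_pM2l//; lra.
Qed.

End lower_bound.

(** * Lower bounds on kappa *)

Section kappa_lower_bounds.
Context {R : realType} (K : nat) (M : set 'rV[R]_K).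
Implicit Types (v w d : 'rV[R]_K).

Lemma BorelRK_closed (A : set 'rV[R]_K) : closed A -> BorelRK A.
Proof.
move=> cA; rewrite -(setCK A) -setTD.
have [_ hC _] := smallest_sigma_algebra setT [set U : set 'rV[R]_K | open U].
apply: hC; apply: sub_sigma_algebra; exact: closed_openC.
Qed.

Lemma continuous_dotv v : continuous (dotv v).
Proof.
have cadd : continuous (fun x : R * R => x.1 + x.2) by exact: add_continuous.
apply: (continuous_big cadd) => i _ d.
by apply: continuousM; [exact: cst_continuous|exact: coord_continuous].
Qed.

Hypothesis K2 : (2 <= K)%N.
Hypothesis cM : closed M.
Hypothesis MS : M `<=` @simplex R K.
Hypothesis M2 : exists d1 d2, M d1 /\ M d2 /\ d1 <> d2.

Let coord01 d i : M d -> 0 <= d ord0 i <= 1.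
Proof. by move=> /MS [+ _]; apply. Qed.

Let normr_bounds (x : R) : `|x| <= 1 -> -1 <= x <= 1.
Proof. by rewrite ler_norml. Qed.

Let dotv_ub v w i d : (forall i, `|v ord0 i| <= 1 /\ `|w ord0 i| <= 1) -> M d ->
  dotv v d + w ord0 i * d ord0 i <= 2.
Proof.
move=> vw Md.
have /andP[_ h1] := dotv_simplex_bounds (MS Md) (fun i => normr_bounds (vw i).1).
by have /andP[d1 d2] := coord01 i Md; have /andP[a1 a2] := normr_bounds (vw i).2; nra.
Qed.

Let dotv_bounds v w d : (forall i, `|v ord0 i| <= 1 /\ `|w ord0 i| <= 1) -> M d ->
  -1 <= dotv v d <= 1.
Proof.
by move=> vw Md; exact: dotv_simplex_bounds (MS Md) (fun i => normr_bounds (vw i).1).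
Qed.

Lemma kappa_ge (Tm : set 'rV[R]_K) v w (x : R) :
  Tm !=set0 -> Tm `<=` M -> Tm <> M -> BorelRK Tm ->
  (forall i, `|v ord0 i| <= 1 /\ `|w ord0 i| <= 1) ->
  x <= sup [set dotv v d | d in M] - sup [set dotv v d | d in Tm] ->
  (forall i, x <= sup [set dotv v d + w ord0 i * d ord0 i | d in M] -
     sup [set dotv v d + w ord0 i * d ord0 i | d in M `\` Tm]) ->
  x <= kappa M.
Proof.
move=> T0 TM TnM BT vw xA xB.
set y := \big[Num.min/(sup [set dotv v d | d in M] -
    sup [set dotv v d | d in Tm])]_(i < K)
  (sup [set dotv v d + w ord0 i * d ord0 i | d in M] -
   sup [set dotv v d + w ord0 i * d ord0 i | d in M `\` Tm]).
apply: (@le_trans _ _ y); first by apply: le_bigmin => // i _.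
apply: ub_le_sup; last by exists Tm, v, w.
(* The supremum defining [kappa] is over a bounded set: the first gap alone is at most
   [1 - (-1)]. *)
exists 2 => _ [T' [v' [w' [[[d T'd] T'M _ _] [vw' ->]]]]].
apply: le_trans (bigmin_le_id _ _ _ _) _.
have h1 : sup [set dotv v' d | d in M] <= 1.
  apply: ge_sup; first by exists (dotv v' d), d => //; exact: T'M.
  by move=> _ [d' Md' <-]; have /andP[] := dotv_bounds vw' Md'.
have h2 : -1 <= sup [set dotv v' d | d in T'].
  have /andP[h _] := dotv_bounds vw' (T'M _ T'd).
  apply: le_trans h _; apply: ub_le_sup; last by exists d.
  by exists 1 => _ [d' /T'M Md' <-]; have /andP[] := dotv_bounds vw' Md'.
lra.
Qed.

Lemma kappa_ge_halfspace v w (theta x : R) :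
  (forall i, `|v ord0 i| <= 1 /\ `|w ord0 i| <= 1) ->
  (exists2 d, M d & dotv v d <= theta) ->
  (exists2 d, M d & theta < dotv v d) ->
  x + theta <= sup [set dotv v d | d in M] ->
  (forall i, exists b,
     (forall d, M d -> theta < dotv v d -> dotv v d + w ord0 i * d ord0 i <= b) /\
     x + b <= sup [set dotv v d + w ord0 i * d ord0 i | d in M]) ->
  x <= kappa M.
Proof.
move=> vw [d1 Md1 d1t] [d2 Md2 d2t] xA xB.
pose Tm := M `&` [set d | dotv v d <= theta].
apply: (@kappa_ge Tm v w) => //.
- by exists d1.
- by move=> d [].
- by move=> TM; move: Md2; rewrite -TM => -[_ /=]; rewrite leNgt d2t.
- apply: BorelRK_closed; apply: closedI => //.
  apply: (@closed_comp _ _ (dotv v) [set y | y <= theta]); last exact: closed_le.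
  by move=> d _; exact: continuous_dotv.
- suff : sup [set dotv v d | d in Tm] <= theta by lra.
  by apply: ge_sup; [exists (dotv v d1), d1|move=> _ [d [_ dt] <-]].
- move=> i; have [b [hb xb]] := xB i.
  suff : sup [set dotv v d + w ord0 i * d ord0 i | d in M `\` Tm] <= b by lra.
  apply: ge_sup.
    exists (dotv v d2 + w ord0 i * d2 ord0 i), d2 => //; split=> // -[_ /=].
    by rewrite leNgt d2t.
  move=> _ [d [Md nT] <-]; apply: hb => //; rewrite ltNge; apply/negP => h.
  exact: nT.
Qed.

(** Two distinct points differ in some coordinate; cutting at the smaller value keeps one and drops
    the other. *)
Lemma kappa_set_nonempty : exists (Tm : set 'rV[R]_K),
  [/\ Tm !=set0, Tm `<=` M, Tm <> M & BorelRK Tm].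
Proof.
have [d1 [d2 [Md1 [Md2 d12]]]] := M2.
have [i [a [b [Ma Mb ab]]]] : exists i a b, [/\ M a, M b & a ord0 i < b ord0 i].
  have [i hi] : exists i, d1 ord0 i != d2 ord0 i.
    apply: contrapT => h; apply: d12; apply/matrixP => j i; rewrite ord1.
    by apply/eqP; apply: contrapT => /negP hi; apply: h; exists i.
  by case/lt_total/orP: hi => h; [exists i, d1, d2|exists i, d2, d1].
exists (M `&` [set d | d ord0 i <= a ord0 i]); split.
- by exists a; split=> /=.
- by move=> d [].
- by move=> TM; move: Mb; rewrite -TM => -[_ /=]; rewrite leNgt ab.
- apply: BorelRK_closed; apply: closedI => //.
  apply: (@closed_comp _ _ (fun d : 'rV[R]_K => d ord0 i) [set y | y <= a ord0 i]);
    last exact: closed_le.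
  by move=> d _; exact: coord_continuous.
Qed.

Lemma kappa_ge0 : 0 <= kappa M.
Proof.
have [Tm [T0 TM TnM BT]] := kappa_set_nonempty.
have dot0 d : dotv (0 : 'rV[R]_K) d = 0.
  by rewrite /dotv big1// => i _; rewrite mxE mul0r.
have sup0 (A : set 'rV[R]_K) : A !=set0 -> forall h : 'rV[R]_K -> R,
    (forall d, h d = 0) -> sup [set h d | d in A] = 0.
  move=> [d Ad] h h0; rewrite (_ : [set h d | d in A] = [set 0]) ?sup1//.
  by apply/seteqP; split=> [_ [d' _ <-]//|_ ->]; exists d.
have MT : M `\` Tm !=set0.
  apply: contrapT => h; apply: TnM; apply/seteqP; split=> // d Md.
  by apply: contrapT => nT; apply: h; exists d.
have M0 : M !=set0 by case: T0 => d /TM; exists d.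
apply: (@kappa_ge Tm 0 0) => //.
- by move=> i; rewrite !mxE normr0.
- by rewrite !sup0// subrr.
- by move=> i; rewrite !sup0 ?subrr// => d; rewrite dot0 mxE mul0r addr0.
Qed.

Let has_ub_coord i : has_ubound [set d ord0 i | d in M].
Proof. by exists 1 => _ [d Md <-]; have /andP[] := coord01 i Md. Qed.

Let has_lb_coord i : has_lbound [set d ord0 i | d in M].
Proof. by exists 0 => _ [d Md <-]; have /andP[] := coord01 i Md. Qed.

Let M0 : M !=set0. Proof. by have [d1 [_ [Md1 _]]] := M2; exists d1. Qed.

Let img0 (h : 'rV[R]_K -> R) : [set h d | d in M] !=set0.
Proof. by case: M0 => d Md; exists (h d), d. Qed.

Let has_ub_perturbed v w i :
  (forall i, `|v ord0 i| <= 1 /\ `|w ord0 i| <= 1) ->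
  has_ubound [set dotv v d + w ord0 i * d ord0 i | d in M].
Proof. by move=> vw; exists 2 => _ [d Md <-]; exact: dotv_ub. Qed.

Let has_ub_dotv v w : (forall i, `|v ord0 i| <= 1 /\ `|w ord0 i| <= 1) ->
  has_ubound [set dotv v d | d in M].
Proof.
by move=> vw; exists 1 => _ [d Md <-]; have /andP[] := dotv_bounds vw Md.
Qed.

Lemma sum_two_coords d (i j : 'I_K) : M d -> i != j ->
  d ord0 i + d ord0 j <= 1.
Proof.
move=> /MS [d01 <-] ij; rewrite (bigD1 i)//= (bigD1 j)/=; last by rewrite eq_sym.
rewrite addrA lerDl sumr_ge0// => k _.
by have /andP[] := d01 k.
Qed.

(** With [u = m - 1/2] and [v = u e_1], the cut is at first coordinate 1/2. The [v]-gap is at least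
    [u * m - u / 2 = u ^+ 2]; the other gaps are at least [u * (1 - u)] and [u / 2], both at least
    [u ^+ 2] as [u <= 1/2]. *)
Lemma kappa_ge_sqr : (Num.max
  (inf [set sup [set d ord0 j | d in M] | j in [set: 'I_K]] - 2^-1) 0) ^+ 2 <= kappa M.
Proof.
set m := inf _; have [u0|u0] := leP (m - 2^-1) 0.
  by rewrite expr0n /=; exact: kappa_ge0.
pose u := m - 2^-1; rewrite -/u.
have mj j : m <= sup [set d ord0 j | d in M].
  apply: ge_inf; last by exists j.
  exists 0 => _ [j' _ <-]; case: M0 => d Md.
  have /andP[h _] := coord01 j' Md; apply: le_trans h _.
  by apply: (ub_le_sup (has_ub_coord j')); exists d.
have K0 : (0 < K)%N by lia.
pose i0 : 'I_K := Ordinal K0; pose i1 : 'I_K := Ordinal K2.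
have i01 : i0 != i1 by [].
have m1 : m <= 1.
  apply: le_trans (mj i0) _; apply: ge_sup; first exact: img0.
  by move=> _ [d Md <-]; have /andP[] := coord01 i0 Md.
have u12 : 0 < u <= 2^-1 by rewrite /u in u0 *; lra.
have [uu0 u2] := andP u12.
pose v : 'rV[R]_K := u *: delta_mx ord0 i0.
pose w : 'rV[R]_K := \row_i (if i == i0 then -1 else 1).
have dv d : dotv v d = u * d ord0 i0.
  rewrite /dotv (bigD1 i0)//= !mxE !eqxx mulr1 big1 ?addr0// => i /negbTE ii.
  by rewrite !mxE ii mulr0 mul0r.
have vw i : `|v ord0 i| <= 1 /\ `|w ord0 i| <= 1.
  rewrite !mxE eqxx /=; split; last by case: ifP; rewrite ?normrN normr1.
  by case: (_ == _); rewrite ?mulr0 ?normr0// mulr1 ger0_norm; lra.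
apply: (@kappa_ge_halfspace v w (u / 2)) => //.
- have [_ [d Md <-] hd] : exists2 y, [set d ord0 i1 | d in M] y & 2^-1 < y.
    by apply: sup_gt; [exact: img0|apply: lt_le_trans (mj i1); rewrite /u in uu0; lra].
  exists d => //; rewrite dv ler_pM2l//.
  by have := sum_two_coords Md i01; lra.
- have [_ [d Md <-] hd] : exists2 y, [set d ord0 i0 | d in M] y & 2^-1 < y.
    by apply: sup_gt; [exact: img0|apply: lt_le_trans (mj i0); rewrite /u in uu0; lra].
  by exists d => //; rewrite dv ltr_pM2l.
- have : m <= sup [set dotv v d | d in M] / u.
    apply: le_trans (mj i0) _; apply: ge_sup; first exact: img0.
    move=> _ [d Md <-]; rewrite ler_pdivlMr// mulrC -dv.
    by apply: (ub_le_sup (has_ub_dotv vw)); exists d.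
  rewrite ler_pdivlMr//; set s := sup _ => hs; rewrite /u in hs uu0 *; nra.
- move=> i; have [ii|ii] := eqVneq i i0.
    have wi : w ord0 i = -1 by rewrite mxE ii eqxx.
    exists (- (1 - u) / 2); split.
      by move=> d Md; rewrite dv ltr_pM2l// wi ii => h; nra.
    set s := sup _.
    (* A point whose second coordinate is near [m] has first coordinate at most about [1 - m], which
       [w = -1] rewards. *)
    have hs : m <= 1 + s / (1 - u).
      apply: le_trans (mj i1) _; apply: ge_sup; first exact: img0.
      move=> _ [d Md <-]; rewrite -lerBlDl ler_pdivlMr; last by lra.
      apply: (@le_trans _ _ (dotv v d + w ord0 i * d ord0 i)).
        by rewrite dv wi ii; have := sum_two_coords Md i01; nra.
      by apply: (ub_le_sup (has_ub_perturbed i vw)); exists d.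
    have : (m - 1) * (1 - u) <= s by rewrite -ler_pdivlMr; lra.
    by rewrite /u in uu0 u2 *; nra.
  have wi : w ord0 i = 1 by rewrite mxE (negbTE ii).
  exists (2^-1 + u / 2); split.
    move=> d Md; rewrite dv ltr_pM2l// wi => h.
    by have := sum_two_coords Md ii; nra.
  have hs : m <= sup [set dotv v d + w ord0 i * d ord0 i | d in M].
    apply: le_trans (mj i) _; apply: ge_sup; first exact: img0.
    move=> _ [d Md <-].
    apply: (@le_trans _ _ (dotv v d + w ord0 i * d ord0 i)).
      by have /andP[h _] := coord01 i0 Md; rewrite dv wi; nra.
    by apply: (ub_le_sup (has_ub_perturbed i vw)); exists d.
  by move: hs; set s := sup _ => hs; rewrite /u in uu0 u2 *; nra.
Qed.

(** Polarisation: among points of nearly maximal norm, a large inner product forces a small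
    distance. *)
Lemma dotv_sqnorm d d' :
  dotv d d' = (sqnorm d + sqnorm d' - sqnorm (d' - d)) / 2.
Proof.
rewrite /dotv /sqnorm -big_split -sumrB mulr_suml; apply: eq_bigr => i _ /=.
by rewrite !mxE; field.
Qed.

Lemma sqr_coord_le_sqnorm d i : d ord0 i ^+ 2 <= sqnorm d.
Proof.
by rewrite /sqnorm (bigD1 i)//= lerDl sumr_ge0// => j _; exact: sqr_ge0.
Qed.

Lemma sqnorm_le1 d : M d -> sqnorm d <= 1.
Proof.
move=> Md; have [_ <-] := MS Md; apply: ler_sum => i _.
by have := coord01 i Md; nra.
Qed.

Let range j := sup [set d ord0 j | d in M] - inf [set d ord0 j | d in M].

(** Above the threshold every coordinate is within [rho / 4] of [ds], so the perturbed form is at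
    most [rho / 8 + w_i ds_i + rho / 4]. As each range is at least [rho], moving in the direction
    [w_i] gains [rho / 2] in the supremum over [M]; the gap [rho / 8] exceeds [rho ^+ 3 / 272]. *)
Lemma kappa_ge_cube (rho : R) : 0 < rho -> (forall j, rho <= range j) ->
  rho ^+ 3 / 272 <= kappa M.
Proof.
move=> rho0 hrho.
pose S := sup [set sqnorm d | d in M].
have hubS : has_ubound [set sqnorm d | d in M].
  by exists 1 => _ [d Md <-]; exact: sqnorm_le1.
have leS d : M d -> sqnorm d <= S by move=> Md; apply: (ub_le_sup hubS); exists d.
have rho1 : rho <= 1.
  have K0 : (0 < K)%N by lia.
  apply: le_trans (hrho (Ordinal K0)) _; rewrite /range.
  have : sup [set d ord0 (Ordinal K0) | d in M] <= 1.
    apply: ge_sup; first exact: img0.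
    by move=> _ [d Md <-]; have /andP[] := coord01 (Ordinal K0) Md.
  have : 0 <= inf [set d ord0 (Ordinal K0) | d in M].
    apply: lb_le_inf; first exact: img0.
    by move=> _ [d Md <-]; have /andP[] := coord01 (Ordinal K0) Md.
  by lra.
have eps0 : 0 < (rho / 17) ^+ 2 by rewrite exprn_gt0// divr_gt0.
have [_ [ds Mds <-] hds] := sup_adherent eps0 (conj (img0 _) hubS).
rewrite -/S in hds.
(* 1/34 makes the gap exactly rho^3/272; 2/34 + 1/17^2 <= 1/16 keeps the points
   above the threshold within rho/4 of ds. *)
pose theta := rho / 8 * (sqnorm ds - rho ^+ 2 / 34).
pose v : 'rV[R]_K := (rho / 8) *: ds.
have dv d : dotv v d = rho / 8 * dotv ds d.
  by rewrite /dotv mulr_sumr; apply: eq_bigr => i _; rewrite mxE mulrA.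
have close d i : M d -> theta < dotv v d -> `|d ord0 i - ds ord0 i| <= rho / 4.
  move=> Md; rewrite dv ltr_pM2l; last by lra.
  rewrite dotv_sqnorm => h.
  have h1 := sqr_coord_le_sqnorm (d - ds) i; rewrite !mxE in h1.
  have h2 := leS d Md.
  have h3 : (d ord0 i - ds ord0 i) ^+ 2 <= (rho / 4) ^+ 2.
    apply: le_trans h1 _; have -> : (rho / 4) ^+ 2 = rho ^+ 2 / 16 by field.
    move: hds eps0; have -> : (rho / 17) ^+ 2 = rho ^+ 2 / 289 by field.
    by move: (rho ^+ 2) h => P h hds P0; lra.
  rewrite -[leRHS]ger0_norm; last by lra.
  by rewrite -ler_sqr ?nnegrE ?normr_ge0// !real_normK ?num_real.
pose w : 'rV[R]_K := \row_i
  (if rho / 2 <= sup [set d ord0 i | d in M] - ds ord0 i then 1 else -1).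
have vw i : `|v ord0 i| <= 1 /\ `|w ord0 i| <= 1.
  rewrite !mxE; split; last by case: ifP; rewrite ?normrN normr1.
  have /andP[a1 a2] := coord01 i Mds.
  by rewrite ger0_norm ?mulr_ge0 ?mulr_ile1//; lra.
have dsds : dotv ds ds = sqnorm ds by apply: eq_bigr => i _; rewrite expr2.
have below : rho / 8 * (rho ^+ 2 / 34) = rho ^+ 3 / 272 by field.
have dvge0 d : M d -> 0 <= dotv v d.
  move=> Md; rewrite /dotv sumr_ge0// => i _; rewrite mxE !mulr_ge0//.
  - by lra.
  - by have /andP[] := coord01 i Mds.
  - by have /andP[] := coord01 i Md.
have dvle d : M d -> dotv v d <= rho / 8.
  move=> Md; have hv i : 0 <= v ord0 i <= rho / 8.
    have /andP[a1 a2] := coord01 i Mds; rewrite mxE mulr_ge0 ?ler_piMr//; lra.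
  by have /andP[] := dotv_simplex_bounds (MS Md) hv.
have far i : w ord0 i * ds ord0 i + rho / 2 <=
    sup [set dotv v d + w ord0 i * d ord0 i | d in M].
  have ubs d : M d -> w ord0 i * d ord0 i <=
      sup [set dotv v d + w ord0 i * d ord0 i | d in M].
    move=> Md; apply: (@le_trans _ _ (dotv v d + w ord0 i * d ord0 i)).
      by rewrite lerDr dvge0.
    by apply: (ub_le_sup (has_ub_perturbed i vw)); exists d.
  move: ubs; set s := sup [set dotv v d + _ | d in M] => ubs.
  have wE : w ord0 i = if rho / 2 <= sup [set d ord0 i | d in M] - ds ord0 i
    then 1 else -1 by rewrite mxE.
  move: ubs; rewrite wE; case: ifPn => h ubs.
    have : sup [set d ord0 i | d in M] <= s.
      apply: ge_sup; first exact: img0.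
      by move=> _ [d Md <-]; rewrite -[leLHS]mul1r; exact: ubs.
    by lra.
  rewrite -ltNge in h.
  have : - s <= inf [set d ord0 i | d in M].
    apply: lb_le_inf; first exact: img0.
    by move=> _ [d Md <-]; rewrite lerNl -mulN1r; exact: ubs.
  by have := hrho i; rewrite /range; lra.
apply: (@kappa_ge_halfspace v w theta) => //.
- have K0 : (0 < K)%N by lia.
  pose i : 'I_K := Ordinal K0.
  (* If no point were below the threshold, every coordinate would stay within [rho / 4] of [ds],
     giving a range of at most [rho / 2]. *)
  apply: contrapT => hno.
  have {}hno d : M d -> theta < dotv v d.
    by move=> Md; rewrite ltNge; apply/negP => h; apply: hno; exists d.
  have : sup [set d ord0 i | d in M] <= ds ord0 i + rho / 4.
    apply: ge_sup; first exact: img0.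
    move=> _ [d Md <-]; have := close d i Md (hno d Md).
    by rewrite ler_norml => /andP[]; lra.
  have : ds ord0 i - rho / 4 <= inf [set d ord0 i | d in M].
    apply: lb_le_inf; first exact: img0.
    move=> _ [d Md <-]; have := close d i Md (hno d Md).
    by rewrite ler_norml => /andP[]; lra.
  by have := hrho i; rewrite /range; lra.
- by exists ds => //; rewrite dv dsds /theta ltr_pM2l ?ltrBlDr ?ltrDl; nra.
- have : dotv v ds <= sup [set dotv v d | d in M].
    by apply: (ub_le_sup (has_ub_dotv vw)); exists ds.
  by rewrite dv dsds /theta; move: below; rewrite mulrBr; lra.
- move=> i; exists (rho / 8 + w ord0 i * ds ord0 i + rho / 4); split.
    move=> d Md hd; have := close d i Md hd; have := dvle d Md.
    have : w ord0 i * (d ord0 i - ds ord0 i) <= `|d ord0 i - ds ord0 i|.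
      apply: le_trans (ler_norm _) _; rewrite normrM ler_piMl//.
      by case: (vw i).
    by rewrite mulrBr; lra.
  apply: le_trans (far i).
  have : rho ^+ 3 <= rho.
    by rewrite -[leRHS]expr1 ler_wiXn2l// ltW.
  by lra.
Qed.

(** The squared norm is at most 1 on the simplex, so the cube of the smallest range dominates the
    product; a zero range is covered by [kappa_ge0]. *)
Lemma kappa_ge_norm_range :
  272^-1 * sup [set sqnorm d | d in M] *
  inf [set (sup [set d ord0 j | d in M] - inf [set d ord0 j | d in M]) ^+ 3
       | j in [set: 'I_K]] <= kappa M.
Proof.
have K0 : (0 < K)%N by lia.
have range_ge0 j : 0 <= range j.
  case: M0 => d Md; rewrite /range subr_ge0; apply: (@le_trans _ _ (d ord0 j)).
    by apply: ge_inf => //; exists d.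
  by apply: (ub_le_sup (has_ub_coord j)); exists d.
pose j0 := [arg min_(j < Ordinal K0) range j]%O.
have j0min j : range j0 <= range j.
  by rewrite /j0; case: arg_minP => // k _; apply.
have infle : inf [set range j ^+ 3 | j in [set: 'I_K]] <= range j0 ^+ 3.
  apply: ge_inf; last by exists j0.
  by exists 0 => _ [j _ <-]; rewrite exprn_ge0.
have S1 : sup [set sqnorm d | d in M] <= 1.
  apply: ge_sup; first exact: img0.
  by move=> _ [d Md <-]; exact: sqnorm_le1.
have S0 : 0 <= sup [set sqnorm d | d in M].
  case: M0 => d Md; apply: (@le_trans _ _ (sqnorm d)).
    by rewrite sumr_ge0// => i _; exact: sqr_ge0.
  by apply: ub_le_sup; [exists 1 => _ [d' Md' <-]; exact: sqnorm_le1|exists d].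
apply: (@le_trans _ _ (range j0 ^+ 3 / 272)).
  rewrite -mulrA mulrC ler_wpM2r ?invr_ge0 ?ler0n//.
  move: S1 S0 infle (exprn_ge0 3 (range_ge0 j0)).
  set s := sup _; set y := inf _; set z := _ ^+ 3 => S1 S0 yz z0.
  apply: le_trans (ler_wpM2l S0 yz) _; exact: ler_piMl.
have [r0|r0] := leP (range j0) 0; last exact: kappa_ge_cube.
have -> : range j0 = 0 by apply/eqP; rewrite eq_le r0 range_ge0.
by rewrite expr0n /= mul0r; exact: kappa_ge0.
Qed.

End kappa_lower_bounds.

(** * The universal constant and the passage to the supremum defining kappa *)

Unset Implicit Arguments.
Set Strict Implicit.
Set Printing Implicit Defensive.

Theorem theorem3p2 (R : realType) (a b : R) (D : set (R -> R))
  (T : (R -> R) -> R) (C : R) (H1 H2 : R -> R) (cminus : R) :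
  a < b ->
  D !=set0 ->
  D `<=` Dcdf a b ->
  (forall (F G : R -> R) (l : R), D F -> D G -> 0 <= l <= 1 ->
     D (fun x => l * F x + (1 - l) * G x)) ->
  0 < C ->
  (forall F G, D F -> Dcdf a b G -> `|T F - T G| <= C * supdist F G) ->
  D H1 -> D H2 ->
  (forall tau, 0 <= tau <= 1 -> D (Jmix H1 H2 tau)) ->
  0 < cminus ->
  (forall tau1 tau2, 0 <= tau1 -> tau1 <= tau2 -> tau2 <= 1 ->
     T (Jmix H1 H2 tau2) - T (Jmix H1 H2 tau1) >= cminus * (tau2 - tau1)) ->
  (exists c : R, 0 < c /\
    forall (K : nat) (M : set 'rV[R]_K),
      (2 <= K)%N -> closed M -> M `<=` @simplex R K ->
      (exists d1 d2, M d1 /\ M d2 /\ d1 <> d2) ->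
      forall (pi : policy R K) (PG : probability R R),
        policy_in M pi ->
        forall n : nat, (K <= n)%N ->
          (ereal_sup [set exp_regret T M mu PG pi n | mu in @line_laws R H1 H2 K]
           >= ((c * kappa M * Num.sqrt (K%:R / n%:R))%R)%:E)%E)
  /\
  (forall (K : nat) (M : set 'rV[R]_K),
      (2 <= K)%N -> closed M -> M `<=` @simplex R K ->
      (exists d1 d2, M d1 /\ M d2 /\ d1 <> d2) ->
      kappa M >= 272^-1 * sup [set sqnorm d | d in M] *
        inf [set (sup [set d ord0 j | d in M] - inf [set d ord0 j | d in M]) ^+ 3
             | j in [set: 'I_K]]
      /\
      kappa M >= (Num.max (inf [set sup [set d ord0 j | d in M] | j in [set: 'I_K]]
                            - 2^-1) 0) ^+ 2).
Proof.
move=> _ _ Dab _ _ _ DH1 DH2 _ cm0 T_mono.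
have [cdfH1 _] := Dab _ DH1; have [cdfH2 _] := Dab _ DH2.
split; last first.
  move=> K M K2 cM MS M2; split; first exact: kappa_ge_norm_range.
  exact: kappa_ge_sqr.
(* One factor 1/8 comes from the step [eta], the other from the split at [q = 1/8]. *)
exists (cminus / 64); split; first by rewrite divr_gt0.
move=> K M K2 cM MS M2 pi PG piM n Kn.
set S := ereal_sup _.
have s0 : 0 < Num.sqrt (K%:R / n%:R) :> R.
  have K0 : (0 < K)%N by exact: ltnW.
  by rewrite sqrtr_gt0 divr_gt0 ?ltr0n// (leq_trans K0 Kn).
have bound x : (exists (Tm : set 'rV[R]_K) (v w : 'rV[R]_K),
    [/\ Tm !=set0, Tm `<=` M, Tm <> M & BorelRK Tm] /\
    (forall i, `|v ord0 i| <= 1 /\ `|w ord0 i| <= 1) /\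
        x = \big[Num.min/ (sup [set dotv v d | d in M] -
                           sup [set dotv v d | d in Tm])]_(i < K)
              (sup [set dotv v d + w ord0 i * d ord0 i | d in M] -
               sup [set dotv v d + w ord0 i * d ord0 i | d in M `\` Tm])) ->
    ((cminus / 64 * x * Num.sqrt (K%:R / n%:R))%:E <= S)%E.
  move=> [Tm [v [w [[T0 TM TnM _] [vw ->]]]]].
  apply: (regret_lower_bound cm0 T_mono cdfH1 cdfH2 PG K2 MS piM Kn T0 TM TnM vw).
    exact: bigmin_le_id.
  by move=> i; exact: bigmin_le.
have [Tm [T0 TM TnM BT]] := kappa_set_nonempty cM M2.
have v0 (i : 'I_K) : `|(0 : 'rV[R]_K) ord0 i| <= 1 by rewrite mxE normr0.
(* One admissible value excludes [S = -oo]; for finite [S] the bound for every value passes to the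
   supremum. *)
have b0 := bound _ (ex_intro _ Tm (ex_intro _ 0 (ex_intro _ 0
  (conj (And4 T0 TM TnM BT) (conj (fun i => conj (v0 i) (v0 i)) erefl))))).
case: S bound b0 => [r| |] bound b0; [|by rewrite leey|by move: b0; rewrite leeNy_eq].
rewrite lee_fin mulrAC -ler_pdivlMl; last by rewrite mulr_gt0// divr_gt0.
apply: ge_sup.
  by eexists; exists Tm, 0, 0.
move=> x /bound; rewrite lee_fin mulrAC -ler_pdivlMl//.
by rewrite mulr_gt0// divr_gt0.
Qed.
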